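(* There is an absolute constant $c'$ such that for every $n\ge c'$, no set of $n$ lines in the plane, labelled $1,\dots,n$, supports all $n$-vertex planar graphs.
   Context: A straight-line crossing-free drawing of a graph maps its vertices to distinct points of the plane and each edge to the closed segment between its endpoints, such that no edge contains a vertex other than its endpoints and no two edges intersect except at a common endpoint. A vertex labelling of an $n$-vertex graph $G=(V,E)$ is a bijection $\pi:V\to\{1,\dots,n\}$. A set of $n$ distinct lines labelled $1,\dots,n$ supports $G$ with vertex labelling $\pi$ if there is a straight-line crossing-free drawing of $G$ in which, for each $i$, the vertex $\pi^{-1}(i)$ is placed on line $i$. The labelled line set supports $G$ if it supports $G$ with every vertex labelling $\pi$ of $G$. *)

(* Defs.v *)
From Stdlib Require Import Reals.
Open Scope R_scope.

Definition point : Type := (R * R)%type.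

Definition line : Type := (R * R * R)%type.
Definition line_ok (l : line) : Prop :=
  let '(a, b, _) := l in a <> 0 \/ b <> 0.
Definition on_line (l : line) (p : point) : Prop :=
  let '(a, b, c) := l in a * fst p + b * snd p = c.
Definition distinct_lines (l1 l2 : line) : Prop :=
  ~ (forall p, on_line l1 p <-> on_line l2 p).

Definition on_seg (p q r : point) : Prop :=
  exists t, 0 <= t <= 1 /\
    r = (fst p + t * (fst q - fst p), snd p + t * (snd q - snd p)).

Definition simple_graph (n : nat) (E : nat -> nat -> Prop) : Prop :=
  (forall u v, E u v -> E v u) /\
  (forall u, ~ E u u) /\
  (forall u v, E u v -> (u < n)%nat /\ (v < n)%nat).

Definition same_edge (u v w x : nat) : Prop :=
  (u = w /\ v = x) \/ (u = x /\ v = w).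

Definition straight_drawing (n : nat) (E : nat -> nat -> Prop) (pos : nat -> point) : Prop :=
  (forall u v, (u < n)%nat -> (v < n)%nat -> pos u = pos v -> u = v) /\
  (forall u v w, E u v -> (w < n)%nat -> w <> u -> w <> v ->
      ~ on_seg (pos u) (pos v) (pos w)) /\
  (forall u v w x, E u v -> E w x -> ~ same_edge u v w x ->
      forall r, on_seg (pos u) (pos v) r -> on_seg (pos w) (pos x) r ->
      exists z, (z = u \/ z = v) /\ (z = w \/ z = x) /\ r = pos z).

Definition cont01 (f : R -> point) : Prop :=
  forall t, 0 <= t <= 1 -> forall eps, eps > 0 -> exists delta, delta > 0 /\
    forall s, 0 <= s <= 1 -> Rabs (s - t) < delta ->
      Rabs (fst (f s) - fst (f t)) < eps /\ Rabs (snd (f s) - snd (f t)) < eps.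

Definition jordan_arc (f : R -> point) (p q : point) : Prop :=
  cont01 f /\ f 0 = p /\ f 1 = q /\
  (forall s t, 0 <= s <= 1 -> 0 <= t <= 1 -> f s = f t -> s = t).

Definition on_arc (f : R -> point) (r : point) : Prop :=
  exists t, 0 <= t <= 1 /\ f t = r.

(* Planar graph: it has a crossing-free drawing in the plane with edges drawn as
   Jordan arcs (arc u v is the arc of edge {u,v} drawn from u to v, used for u < v). *)
Definition planar (n : nat) (E : nat -> nat -> Prop) : Prop :=
  exists (pos : nat -> point) (arc : nat -> nat -> R -> point),
    (forall u v, (u < n)%nat -> (v < n)%nat -> pos u = pos v -> u = v) /\
    (forall u v, E u v -> (u < v)%nat -> jordan_arc (arc u v) (pos u) (pos v)) /\
    (forall u v w, E u v -> (u < v)%nat -> (w < n)%nat -> w <> u -> w <> v ->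
        ~ on_arc (arc u v) (pos w)) /\
    (forall u v w x, E u v -> (u < v)%nat -> E w x -> (w < x)%nat ->
        ~ (u = w /\ v = x) ->
        forall r, on_arc (arc u v) r -> on_arc (arc w x) r ->
        exists z, (z = u \/ z = v) /\ (z = w \/ z = x) /\ r = pos z).

(* Vertex labelling: bijection of {0..n-1} (labels shifted by one: label i+1 <-> i). *)
Definition labelling (n : nat) (pi : nat -> nat) : Prop :=
  (forall v, (v < n)%nat -> (pi v < n)%nat) /\
  (forall u v, (u < n)%nat -> (v < n)%nat -> pi u = pi v -> u = v) /\
  (forall i, (i < n)%nat -> exists v, (v < n)%nat /\ pi v = i).

Definition supports_with (n : nat) (L : nat -> line) (E : nat -> nat -> Prop)
  (pi : nat -> nat) : Prop :=
  exists pos : nat -> point, straight_drawing n E pos /\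
    forall v, (v < n)%nat -> on_line (L (pi v)) (pos v).

Definition supports (n : nat) (L : nat -> line) (E : nat -> nat -> Prop) : Prop :=
  forall pi, labelling n pi -> supports_with n L E pi.

(* Main.v *)
Require Import Defs.
From Stdlib Require Import Reals Lra Lia Psatz List Classical ClassicalEpsilon Sorted.
Import ListNotations.

(* The graph is the cube of a path v_0, v_1, ... (adjacency at distance at most 3), placed on
   34 lines selected by Ramsey's theorem; the remaining vertices are isolated.
   In any straight-line drawing, the triangles v_k v_(k+1) v_(k+2) are nested inwards from
   the outer face in both directions along the path, and in each direction all of them have
   the same orientation. Assigning three lines a < b < c of the family to consecutive
   vertices in suitable orders produces positively ordered as well as negatively ordered
   triples, so some triangle is positively oriented with respect to the order of its lines
   and contains many later vertices, on lines before a, between a and b, between b and c,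
   and after c, one of which lies on the positive side of a, b and c. For lines in bent
   position this is impossible, and for parallel lines a triangle cannot contain a vertex
   on a line outside the strip of its own three lines. *)

(** * Triangles and straight-line drawings *)

Definition comb (a b c : R) (p q r : point) : point :=
  (a * fst p + b * fst q + c * fst r, a * snd p + b * snd q + c * snd r).

Definition inside (p q r x : point) : Prop :=
  exists a b c, 0 < a /\ 0 < b /\ 0 < c /\ a + b + c = 1 /\ x = comb a b c p q r.

Definition det (p q r : point) : R :=
  (fst q - fst p) * (snd r - snd p) - (snd q - snd p) * (fst r - fst p).

Lemma barycentric (p q r x : point) :
  det p q r <> 0 -> exists a b c, a + b + c = 1 /\ x = comb a b c p q r.
Proof.
  destruct p as [p1 p2], q as [q1 q2], r as [r1 r2], x as [x1 x2].
  unfold det, comb; simpl; intros Hd.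
  exists (det (x1,x2) (q1,q2) (r1,r2) / det (p1,p2) (q1,q2) (r1,r2)),
         (det (p1,p2) (x1,x2) (r1,r2) / det (p1,p2) (q1,q2) (r1,r2)),
         (det (p1,p2) (q1,q2) (x1,x2) / det (p1,p2) (q1,q2) (r1,r2)).
  unfold det; simpl; split; [field; exact Hd|].
  f_equal; field; exact Hd.
Qed.

Lemma collinear_between (p q r : point) :
  det p q r = 0 -> on_seg p q r \/ on_seg q r p \/ on_seg r p q.
Proof.
  destruct p as [p1 p2], q as [q1 q2], r as [r1 r2]; unfold det, on_seg; simpl.
  intros Hd.
  destruct (classic ((p1, p2) = (q1, q2))) as [e|Hne].
  { injection e as -> ->. right; left. exists 0; split; [lra|f_equal; ring]. }
  assert (Ht : exists t, r1 = p1 + t * (q1 - p1) /\ r2 = p2 + t * (q2 - p2)).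
  { destruct (Req_dec q1 p1) as [e1|n1].
    - assert (q2 <> p2) by (intros e2; apply Hne; congruence).
      exists ((r2 - p2) / (q2 - p2)); split; [|field; lra].
      subst q1. assert (h : (q2 - p2) * (r1 - p1) = 0) by lra.
      apply Rmult_integral in h. destruct h; [lra|]. lra.
    - exists ((r1 - p1) / (q1 - p1)); split; [field; lra|].
      apply (Rmult_eq_reg_l (q1 - p1)); [|lra].
      replace ((q1 - p1) * (p2 + (r1 - p1) / (q1 - p1) * (q2 - p2)))
        with ((q1 - p1) * p2 + (r1 - p1) * (q2 - p2)) by (field; lra).
      lra. }
  destruct Ht as [t [-> ->]].
  destruct (Rle_dec 0 t) as [h0|h0]; [destruct (Rle_dec t 1) as [h1|h1]|].
  - left; exists t; split; [lra|reflexivity].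
  - right; right; exists (1 - / t).
    assert (0 < / t) by (apply Rinv_0_lt_compat; lra).
    assert (/ t < 1) by (rewrite <- Rinv_1; apply Rinv_lt_contravar; lra).
    split; [lra|f_equal; field; lra].
  - right; left; exists (/ (1 - t)).
    assert (0 < / (1 - t)) by (apply Rinv_0_lt_compat; lra).
    assert (/ (1 - t) < 1) by (rewrite <- Rinv_1; apply Rinv_lt_contravar; lra).
    split; [lra|f_equal; field; lra].
Qed.

Lemma inside_rotate (p q r x : point) : inside p q r x -> inside q r p x.
Proof.
  intros (a & b & c & Ha & Hb & Hc & Hs & ->).
  exists b, c, a; repeat split; try lra. unfold comb; f_equal; ring.
Qed.

Lemma inside_swap (p q r x : point) : inside p q r x -> inside q p r x.
Proof.
  intros (a & b & c & Ha & Hb & Hc & Hs & ->).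
  exists b, a, c; repeat split; try lra. unfold comb; f_equal; ring.
Qed.

Lemma inside_trans (p q r s x : point) :
  inside p q r s -> inside q r s x -> inside p q r x.
Proof.
  intros (a & b & c & Ha & Hb & Hc & Hs & ->) (a' & b' & c' & Ha' & Hb' & Hc' & Hs' & ->).
  exists (c' * a), (a' + c' * b), (b' + c' * c).
  repeat split; try nra.
  unfold comb; simpl; f_equal; ring.
Qed.

(** Replacing the corner [p] by an interior point scales the signed area by the barycentric weight
    of [p], so the area shrinks and the orientation is kept. *)
Lemma inside_det (p q r s : point) :
  inside p q r s -> exists k, 0 < k < 1 /\ det q r s = k * det p q r.
Proof.
  intros (a & b & c & Ha & Hb & Hc & Hs & ->).
  exists a; split; [lra|].
  replace c with (1 - a - b) by lra.
  unfold det, comb; simpl; ring.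
Qed.

Lemma det_rotate (p q r : point) : det q r p = det p q r.
Proof. unfold det; ring. Qed.

Lemma det_swap (p q r : point) : det p r q = - det p q r.
Proof. unfold det; ring. Qed.

(** The first coordinate vanishes at time [l / (l - a)]; if the second is already negative then, its
    own zero [m / (m - b)] comes earlier and is taken instead. *)
Lemma exit_time2 (l m a b : R) :
  0 < l -> 0 < m -> a <= 0 ->
  exists t, 0 <= t <= 1 /\ 0 <= l + t * (a - l) /\ 0 <= m + t * (b - m) /\
    (l + t * (a - l) = 0 \/ m + t * (b - m) = 0).
Proof.
  intros Hl Hm Ha.
  assert (Hi : 0 < / (l - a)) by (apply Rinv_0_lt_compat; lra).
  assert (Ht : l / (l - a) * (l - a) = l) by (field; lra).
  set (t := l / (l - a)) in *.
  assert (0 < t <= 1) by nra.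
  destruct (Rle_dec 0 (m + t * (b - m))) as [h|h].
  - exists t. repeat split; try nra; left; nra.
  - assert (Hb : b < 0) by nra.
    assert (Hi2 : 0 < / (m - b)) by (apply Rinv_0_lt_compat; lra).
    assert (Hu : m / (m - b) * (m - b) = m) by (field; lra).
    set (u := m / (m - b)) in *.
    assert (0 < u <= 1) by nra.
    assert (u < t) by nra.
    exists u. repeat split; try nra; right; nra.
Qed.

Lemma exit_time3 (l m n a b c : R) :
  0 < l -> 0 < m -> 0 < n -> a <= 0 ->
  exists t, 0 <= t <= 1 /\ 0 <= l + t * (a - l) /\ 0 <= m + t * (b - m) /\
    0 <= n + t * (c - n) /\
    (l + t * (a - l) = 0 \/ m + t * (b - m) = 0 \/ n + t * (c - n) = 0).
Proof.
  intros Hl Hm Hn Ha.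
  destruct (exit_time2 l m a b) as (t & Ht & H1 & H2 & H3); auto.
  destruct (Rle_dec 0 (n + t * (c - n))) as [h|h].
  - exists t; tauto.
  - assert (Hc : c <= 0) by nra.
    assert (0 < t) by nra.
    assert (Hi2 : 0 < / (n - c)) by (apply Rinv_0_lt_compat; lra).
    assert (Hu : n / (n - c) * (n - c) = n) by (field; lra).
    set (u := n / (n - c)) in *.
    assert (0 < u <= 1) by nra.
    assert (u < t) by nra.
    (* Since [u] is a fraction [s] of [t], the first two coordinates at time [u] are convex
       combinations of their values at times 0 and [t], both nonnegative. *)
    assert (Hut : exists s, 0 <= s <= 1 /\ u = s * t).
    { exists (u / t). split; [|field; lra].
      assert (u / t * t = u) by (field; lra). split; nra. }
    destruct Hut as (s & Hs & Hust).
    exists u. split; [lra|]. split; [|split; [|split; [nra|right; right; nra]]].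
    + replace (l + u * (a - l)) with ((1 - s) * l + s * (l + t * (a - l)))
        by (rewrite Hust; ring). nra.
    + replace (m + u * (b - m)) with ((1 - s) * m + s * (m + t * (b - m)))
        by (rewrite Hust; ring). nra.
Qed.

Lemma exit_time (l m n a b c : R) :
  0 < l -> 0 < m -> 0 < n -> ~ (0 < a /\ 0 < b /\ 0 < c) ->
  exists t, 0 <= t <= 1 /\ 0 <= l + t * (a - l) /\ 0 <= m + t * (b - m) /\
    0 <= n + t * (c - n) /\
    (l + t * (a - l) = 0 \/ m + t * (b - m) = 0 \/ n + t * (c - n) = 0).
Proof.
  intros Hl Hm Hn Hneg.
  destruct (Rlt_dec 0 a) as [ha|ha]; [destruct (Rlt_dec 0 b) as [hb|hb]|].
  - destruct (Rlt_dec 0 c) as [hc|hc]; [tauto|].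
    destruct (exit_time3 n l m c a b) as (t & Ht); try lra. exists t; tauto.
  - destruct (exit_time3 m l n b a c) as (t & Ht); try lra. exists t; tauto.
  - destruct (exit_time3 l m n a b c) as (t & Ht); try lra. exists t; tauto.
Qed.

Lemma edges_disjoint (n : nat) (E : nat -> nat -> Prop) (pos : nat -> point)
  (u v w x : nat) (r : point) :
  straight_drawing n E pos -> E u v -> E w x ->
  u <> w -> u <> x -> v <> w -> v <> x ->
  on_seg (pos u) (pos v) r -> on_seg (pos w) (pos x) r -> False.
Proof.
  intros (_ & _ & H) Huv Hwx n1 n2 n3 n4 H1 H2.
  destruct (H u v w x Huv Hwx) with (r := r) as (z & [->| ->] & [e|e] & _); auto.
  unfold same_edge; tauto.
Qed.

Lemma triangle_noncollinear (n : nat) (E : nat -> nat -> Prop) (pos : nat -> point)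
  (p q r : nat) :
  straight_drawing n E pos -> (p < n)%nat -> (q < n)%nat -> (r < n)%nat ->
  E p q -> E q r -> E r p -> p <> q -> q <> r -> r <> p ->
  det (pos p) (pos q) (pos r) <> 0.
Proof.
  intros (_ & H & _) Hp Hq Hr Epq Eqr Erp n1 n2 n3 Hd.
  destruct (collinear_between _ _ _ Hd) as [h|[h|h]].
  - apply (H p q r); auto.
  - apply (H q r p); auto.
  - apply (H r p q); auto.
Qed.

(** Walking from [x] towards an outside point [y], the first barycentric coordinate to vanish names
    the side of the triangle that is hit. That side is an edge with no end in common with the edge
    [x y]. *)
Lemma inside_adjacent (n : nat) (E : nat -> nat -> Prop) (pos : nat -> point)
  (p q r x y : nat) :
  straight_drawing n E pos -> (p < n)%nat -> (q < n)%nat -> (r < n)%nat ->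
  E p q -> E q r -> E r p -> E x y -> NoDup (p :: q :: r :: x :: y :: nil) ->
  inside (pos p) (pos q) (pos r) (pos x) -> inside (pos p) (pos q) (pos r) (pos y).
Proof.
  intros HD Hp Hq Hr Epq Eqr Erp Exy Hnd (l & m & k & Hl & Hm & Hk & Hs & Hx).
  repeat rewrite NoDup_cons_iff in Hnd; simpl in Hnd.
  assert (Hdet : det (pos p) (pos q) (pos r) <> 0)
    by (apply (triangle_noncollinear n E); auto; intros ->; tauto).
  destruct (barycentric _ _ _ (pos y) Hdet) as (a & b & c & Hs' & Hy).
  destruct (classic (0 < a /\ 0 < b /\ 0 < c)) as [(ha & hb & hc)|Hneg].
  { exists a, b, c; auto. }
  exfalso.
  destruct (exit_time l m k a b c Hl Hm Hk Hneg) as (t & Ht & H1 & H2 & H3 & H0).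
  assert (Hxy : on_seg (pos x) (pos y)
    (comb (l + t * (a - l)) (m + t * (b - m)) (k + t * (c - k)) (pos p) (pos q) (pos r))).
  { exists t; split; [exact Ht|]. rewrite Hx, Hy; unfold comb; simpl; f_equal; ring. }
  assert (Hsum : (l + t * (a - l)) + (m + t * (b - m)) + (k + t * (c - k)) = 1) by nra.
  revert Hxy H1 H2 H3 H0 Hsum.
  generalize (l + t * (a - l)) (m + t * (b - m)) (k + t * (c - k)).
  intros A B C Hxy H1 H2 H3 H0 Hsum.
  destruct H0 as [->|[->| ->]].
  - refine (edges_disjoint n E pos x y q r _ HD Exy Eqr _ _ _ _ Hxy _);
      [intros ->; tauto ..|].
    exists C; split; [lra|]. unfold comb; replace B with (1 - C) by lra; f_equal; ring.
  - refine (edges_disjoint n E pos x y r p _ HD Exy Erp _ _ _ _ Hxy _);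
      [intros ->; tauto ..|].
    exists A; split; [lra|]. unfold comb; replace C with (1 - A) by lra; f_equal; ring.
  - refine (edges_disjoint n E pos x y p q _ HD Exy Epq _ _ _ _ Hxy _);
      [intros ->; tauto ..|].
    exists B; split; [lra|]. unfold comb; replace A with (1 - B) by lra; f_equal; ring.
Qed.

(** The last two inequalities say that [a / l] is the least of [a / l], [b / m], [c / k]. Taking
    weight [a / l] at [s] uses up the share of [p] and leaves nonnegative weights at [q] and [r]; a
    zero weight puts [x] on a segment from [s] to a corner. *)
Lemma subtriangle_least (p q r s x : point) (a b c l m k : R) :
  0 < a -> 0 < b -> 0 < c -> 0 < l -> 0 < m -> 0 < k ->
  a + b + c = 1 -> l + m + k = 1 ->
  s = comb l m k p q r -> x = comb a b c p q r ->
  a * m <= b * l -> a * k <= c * l ->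
  inside q r s x \/ on_seg q s x \/ on_seg r s x.
Proof.
  intros Ha Hb Hc Hl Hm Hk H1 H2 -> -> Hab Hac.
  assert (Hi : 0 < / l) by (apply Rinv_0_lt_compat; lra).
  assert (Ht : a / l * l = a) by (field; lra).
  set (t := a / l) in *.
  assert (Ht0 : 0 < t) by nra.
  assert (Hb' : 0 <= b - t * m) by nra.
  assert (Hc' : 0 <= c - t * k) by nra.
  assert (Hsum : (b - t * m) + (c - t * k) + t = 1) by nra.
  destruct (Rle_lt_or_eq_dec _ _ Hb') as [hb|hb];
    [destruct (Rle_lt_or_eq_dec _ _ Hc') as [hc|hc]|].
  - left. exists (b - t * m), (c - t * k), t. repeat split; try lra.
    unfold comb; simpl. rewrite <- Ht. f_equal; ring.
  - right; left. exists t. split; [lra|].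
    replace b with (1 - t + t * m) by lra. replace c with (t * k) by lra.
    unfold comb; simpl. rewrite <- Ht. f_equal; ring.
  - right; right. exists t. split; [lra|].
    replace c with (1 - t + t * k) by lra. replace b with (t * m) by lra.
    unfold comb; simpl. rewrite <- Ht. f_equal; ring.
Qed.

Lemma subtriangle_cases (p q r s x : point) :
  inside p q r s -> inside p q r x ->
  (inside q r s x \/ inside r p s x \/ inside p q s x) \/
  (on_seg p s x \/ on_seg q s x \/ on_seg r s x).
Proof.
  intros (l & m & k & Hl & Hm & Hk & H1 & Hs) (a & b & c & Ha & Hb & Hc & H2 & Hx).
  assert (Hrot : forall u v w, comb u v w p q r = comb v w u q r p)
    by (intros; unfold comb; f_equal; ring).
  assert (Hrot' : forall u v w, comb u v w p q r = comb w u v r p q)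
    by (intros; unfold comb; f_equal; ring).
  (* Transitivity for the ratios [x' / u], [y / v], [z / w] in cross-multiplied form; it excludes
     the two cyclic outcomes of the comparisons below. *)
  assert (Hpq : forall u v w x' y z : R, 0 < u -> 0 < v -> 0 < w ->
    x' * v <= y * u -> y * w <= z * v -> x' * w <= z * u).
  { intros u v w x' y z Hu Hv Hw h1 h2.
    apply (Rmult_le_reg_l v); [lra|]. nra. }
  destruct (Rle_dec (a * m) (b * l)) as [h1|h1]; destruct (Rle_dec (b * k) (c * m)) as [h2|h2];
    destruct (Rle_dec (a * k) (c * l)) as [h3|h3].
  all: try (destruct (subtriangle_least p q r s x a b c l m k) as [h|[h|h]]; tauto || lra).
  all: try (destruct (subtriangle_least q r p s x b c a m k l) as [h|[h|h]];
     rewrite <- ?Hrot; auto; try lra; tauto).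
  all: try (destruct (subtriangle_least r p q s x c a b k l m) as [h|[h|h]];
     rewrite <- ?Hrot'; auto; try lra; tauto).
  all: exfalso.
  - apply h3; eapply Hpq; [exact Hl|exact Hm|exact Hk|exact h1|exact h2].
  - assert (a * m <= b * l); [|tauto]. eapply Hpq; [exact Hl|exact Hk|exact Hm|exact h3|lra].
Qed.

(** The unit step of the nesting. The edge [s x] traps [x] in [p q r], hence in one of three
    subtriangles at [s]. The edges from [x] to [q] and [r] exclude those opposite [q] and [r]; no
    edge from [x] to [p] is assumed, so the one opposite [p] survives. *)
Lemma inside_next (n : nat) (E : nat -> nat -> Prop) (pos : nat -> point)
  (p q r s x : nat) :
  straight_drawing n E pos -> (forall u v, E u v -> E v u) ->
  (p < n)%nat -> (q < n)%nat -> (r < n)%nat -> (s < n)%nat -> (x < n)%nat ->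
  E p q -> E q r -> E r p -> E p s -> E q s -> E r s -> E q x -> E r x -> E s x ->
  NoDup (p :: q :: r :: s :: x :: nil) ->
  inside (pos p) (pos q) (pos r) (pos s) -> inside (pos q) (pos r) (pos s) (pos x).
Proof.
  intros HD Hsym Hp Hq Hr Hs Hx Epq Eqr Erp Eps Eqs Ers Eqx Erx Esx Hnd Hins.
  assert (Hnd' := Hnd).
  repeat rewrite NoDup_cons_iff in Hnd'; simpl in Hnd'.
  assert (Hdet : det (pos p) (pos q) (pos r) <> 0)
    by (apply (triangle_noncollinear n E); auto; intros ->; tauto).
  assert (Hx1 : inside (pos p) (pos q) (pos r) (pos x))
    by (apply (inside_adjacent n E pos p q r s x); auto).
  (* [x] cannot lie in a subtriangle opposite to [u], since the edge from [x] would
     drag the outer vertex [u] into it. *)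
  assert (Hno : forall u v w, (u < n)%nat -> (v < n)%nat -> (w < n)%nat ->
    E v w -> E w s -> E s v -> E x u -> NoDup (v :: w :: s :: x :: u :: nil) ->
    inside (pos u) (pos v) (pos w) (pos s) -> det (pos u) (pos v) (pos w) <> 0 ->
    ~ inside (pos v) (pos w) (pos s) (pos x)).
  { intros u v w Hu Hv Hw Evw Ews Esv Exu Hnd2 Hs2 Hd2 Hx2.
    apply (inside_adjacent n E pos v w s x u) in Hx2; auto.
    (* Areas conflict: [s] in [u v w] makes [v w s] the smaller triangle, while [u] in [v w s] makes
       it the larger one. *)
    apply inside_det in Hs2. destruct Hs2 as (k & Hk & e1).
    apply inside_rotate, inside_rotate in Hx2.
    apply inside_det in Hx2. destruct Hx2 as (k' & Hk' & e2).
    rewrite (det_rotate (pos u)), <- (det_rotate (pos s)), e1 in e2.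
    assert (k' * k < 1) by nra.
    apply Hd2. nra. }
  assert (Hns : forall u, (u < n)%nat -> E u s -> u <> x -> s <> x ->
    ~ on_seg (pos u) (pos s) (pos x)) by (intros; apply HD; auto).
  destruct (subtriangle_cases _ _ _ _ _ Hins Hx1) as [[h|[h|h]]|[h|[h|h]]]; auto; exfalso.
  - apply (Hno q r p); auto.
    + change (NoDup ((r :: p :: s :: x :: nil) ++ q :: nil)).
      repeat constructor; simpl; intuition congruence.
    + apply inside_rotate; auto.
    + rewrite det_rotate; auto.
  - apply (Hno r p q); auto.
    + repeat constructor; simpl; intuition congruence.
    + apply inside_rotate, inside_rotate; auto.
    + rewrite <- det_rotate; auto.
  - apply (Hns p); auto; intros ->; tauto.
  - apply (Hns q); auto; intros ->; tauto.
  - apply (Hns r); auto; intros ->; tauto.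
Qed.

(** * Drawings of the cube of a path *)

Lemma quadrilateral_crossing (p q r s : point) (a b c : R) :
  a < 0 -> 0 < b -> 0 < c -> a + b + c = 1 -> s = comb a b c p q r ->
  exists z, on_seg p s z /\ on_seg q r z.
Proof.
  intros Ha Hb Hc H1 ->.
  assert (Hi : 0 < / (1 - a)) by (apply Rinv_0_lt_compat; lra).
  assert (Ht : / (1 - a) * (1 - a) = 1) by (field; lra).
  set (t := / (1 - a)) in *.
  exists (comb 0 (b * t) (c * t) p q r). split.
  - exists t; split; [nra|]. unfold comb; simpl.
    replace (a * t) with (t - 1) by lra.
    f_equal.
    + replace (t * (a * fst p + b * fst q + c * fst r - fst p))
        with (t * b * fst q + t * c * fst r - (t * (1 - a)) * fst p) by ring.
      rewrite Ht; ring.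
    + replace (t * (a * snd p + b * snd q + c * snd r - snd p))
        with (t * b * snd q + t * c * snd r - (t * (1 - a)) * snd p) by ring.
      rewrite Ht; ring.
  - exists (c * t); split; [nra|]. unfold comb; simpl.
    replace (b * t) with (1 - c * t) by (replace b with (1 - a - c) by lra; lra).
    f_equal; ring.
Qed.

Lemma inside_from_two_negative (p q r s : point) (a b c : R) :
  0 < a -> b < 0 -> c < 0 -> a + b + c = 1 -> s = comb a b c p q r -> inside q r s p.
Proof.
  intros Ha Hb Hc H1 ->.
  assert (Hi : 0 < / a) by (apply Rinv_0_lt_compat; lra).
  exists (- b * / a), (- c * / a), (/ a). repeat split; try nra.
  - replace c with (1 - a - b) by lra; field; lra.
  - destruct p as [p1 p2], q as [q1 q2], r as [r1 r2]. unfold comb; simpl.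
    f_equal; field; lra.
Qed.

(** The signs of the barycentric coordinates of [s] decide: all positive puts [s] inside, exactly
    one negative makes two opposite edges cross, and two negative put the corner with the positive
    coordinate inside the other three. A zero would make three vertices collinear. *)
Lemma k4_drawing (n : nat) (E : nat -> nat -> Prop) (pos : nat -> point) (p q r s : nat) :
  straight_drawing n E pos -> (forall u v, E u v -> E v u) ->
  (p < n)%nat -> (q < n)%nat -> (r < n)%nat -> (s < n)%nat ->
  E p q -> E q r -> E r p -> E p s -> E q s -> E r s ->
  NoDup (p :: q :: r :: s :: nil) ->
  inside (pos p) (pos q) (pos r) (pos s) \/ inside (pos q) (pos r) (pos s) (pos p) \/
  inside (pos r) (pos p) (pos s) (pos q) \/ inside (pos p) (pos q) (pos s) (pos r).
Proof.
  intros HD Hsym Hp Hq Hr Hs Epq Eqr Erp Eps Eqs Ers Hnd.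
  repeat rewrite NoDup_cons_iff in Hnd; simpl in Hnd.
  assert (Hnc : forall u v w, (u < n)%nat -> (v < n)%nat -> (w < n)%nat ->
    E u v -> E v w -> E w u -> u <> v -> v <> w -> w <> u ->
    det (pos u) (pos v) (pos w) <> 0)
    by (intros; apply (triangle_noncollinear n E); auto).
  assert (Hd : det (pos p) (pos q) (pos r) <> 0) by (apply Hnc; auto; intros ->; tauto).
  destruct (barycentric _ _ _ (pos s) Hd) as (a & b & c & H1 & Hx).
  assert (Ha : a <> 0).
  { intros ->. apply (Hnc q r s); auto; try (intros ->; tauto).
    rewrite Hx; unfold det, comb; simpl; replace c with (1 - b) by lra; ring. }
  assert (Hb : b <> 0).
  { intros ->. apply (Hnc r p s); auto; try (intros ->; tauto).
    rewrite Hx; unfold det, comb; simpl; replace c with (1 - a) by lra; ring. }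
  assert (Hc : c <> 0).
  { intros ->. apply (Hnc p q s); auto; try (intros ->; tauto).
    rewrite Hx; unfold det, comb; simpl; replace b with (1 - a) by lra; ring. }
  assert (Hx' : pos s = comb b c a (pos q) (pos r) (pos p))
    by (rewrite Hx; unfold comb; f_equal; ring).
  assert (Hx'' : pos s = comb c a b (pos r) (pos p) (pos q))
    by (rewrite Hx; unfold comb; f_equal; ring).
  assert (Hcross : forall u v w x, E u v -> E w x -> NoDup (u :: v :: w :: x :: nil) ->
    ~ exists z, on_seg (pos u) (pos v) z /\ on_seg (pos w) (pos x) z).
  { intros u v w x Euv Ewx Hn (z & h1 & h2).
    repeat rewrite NoDup_cons_iff in Hn; simpl in Hn.
    apply (edges_disjoint n E pos u v w x z HD); auto; intros ->; tauto. }
  destruct (Rlt_dec 0 a) as [ha|ha], (Rlt_dec 0 b) as [hb|hb], (Rlt_dec 0 c) as [hc|hc].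
  - left. exists a, b, c; auto.
  - exfalso; apply (Hcross r s p q); auto;
      [|apply (quadrilateral_crossing _ _ _ _ c a b); auto; lra].
    repeat constructor; simpl; intuition congruence.
  - exfalso; apply (Hcross q s r p); auto;
      [|apply (quadrilateral_crossing _ _ _ _ b c a); auto; lra].
    repeat constructor; simpl; intuition congruence.
  - right; left. apply (inside_from_two_negative _ _ _ _ a b c); auto; lra.
  - exfalso; apply (Hcross p s q r); auto;
      [|apply (quadrilateral_crossing _ _ _ _ a b c); auto; lra].
    repeat constructor; simpl; intuition congruence.
  - right; right; left. apply (inside_from_two_negative _ _ _ _ b c a); auto; lra.
  - right; right; right. apply (inside_from_two_negative _ _ _ _ c a b); auto; lra.
  - lra.
Qed.

Definition path_cube (N i j : nat) : Prop :=
  (i < N)%nat /\ (j < N)%nat /\ i <> j /\ (i <= j + 3)%nat /\ (j <= i + 3)%nat.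

Lemma path_cube_sym (N i j : nat) : path_cube N i j -> path_cube N j i.
Proof. unfold path_cube; lia. Qed.

Ltac inside_perm :=
  first [ assumption
        | apply inside_rotate; assumption
        | apply inside_rotate, inside_rotate; assumption
        | apply inside_swap; assumption
        | apply inside_swap, inside_rotate; assumption
        | apply inside_swap, inside_rotate, inside_rotate; assumption ].

Ltac cube_side :=
  repeat first [apply NoDup_cons | apply NoDup_nil];
  first [exact path_cube_sym | unfold path_cube; simpl; lia | simpl; lia | idtac].

Lemma path_cube_next (N : nat) (P : nat -> point) (k : nat) :
  straight_drawing N (path_cube N) P -> (k + 4 < N)%nat ->
  inside (P k) (P (k + 1)%nat) (P (k + 2)%nat) (P (k + 3)%nat) ->
  inside (P (k + 1)%nat) (P (k + 2)%nat) (P (k + 3)%nat) (P (k + 4)%nat).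
Proof.
  intros HD Hk.
  apply (inside_next N (path_cube N) P k (k+1) (k+2) (k+3) (k+4));
    auto using path_cube_sym; cube_side.
Qed.

(* Wherever the outer face is, triangles of consecutive vertices are nested inwards
   from it in both directions along the path. *)
Lemma path_cube_direction (N : nat) (P : nat -> point) (k : nat) :
  straight_drawing N (path_cube N) P -> (k + 5 < N)%nat ->
  inside (P (k + 2)%nat) (P (k + 3)%nat) (P (k + 4)%nat) (P (k + 5)%nat) \/
  inside (P (k + 3)%nat) (P (k + 2)%nat) (P (k + 1)%nat) (P k).
Proof.
  intros HD Hk.
  destruct (k4_drawing N (path_cube N) P (k+1) (k+2) (k+3) (k+4)) as [h|[h|[h|h]]];
    auto using path_cube_sym; cube_side.
  - left.
    apply (inside_next N (path_cube N) P (k+1) (k+2) (k+3) (k+4) (k+5));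
      auto using path_cube_sym; cube_side.
  - right.
    apply (inside_next N (path_cube N) P (k+4) (k+3) (k+2) (k+1) k);
      auto using path_cube_sym; cube_side. inside_perm.
  (* If one of the two middle vertices is the inner one, it takes the role of [s] in [inside_next]
     while [k+1] stays [p]: the vertex [k+5] is adjacent to the other three. *)
  - left.
    assert (inside (P (k+3)%nat) (P (k+4)%nat) (P (k+2)%nat) (P (k+5)%nat)); [|inside_perm].
    apply (inside_next N (path_cube N) P (k+1) (k+3) (k+4) (k+2) (k+5));
      auto using path_cube_sym; cube_side. inside_perm.
  - left.
    assert (inside (P (k+2)%nat) (P (k+4)%nat) (P (k+3)%nat) (P (k+5)%nat)); [|inside_perm].
    apply (inside_next N (path_cube N) P (k+1) (k+2) (k+4) (k+3) (k+5));
      auto using path_cube_sym; cube_side.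
Qed.

Lemma path_cube_nested (N : nat) (P : nat -> point) (k : nat) :
  straight_drawing N (path_cube N) P -> (k + 3 < N)%nat ->
  inside (P 0%nat) (P 1%nat) (P 2%nat) (P 3%nat) ->
  inside (P k) (P (k + 1)%nat) (P (k + 2)%nat) (P (k + 3)%nat).
Proof.
  intros HD Hk H0; induction k as [|k IH]; [exact H0|].
  replace (S k + 3)%nat with (k + 4)%nat by lia.
  replace (S k + 2)%nat with (k + 3)%nat by lia.
  replace (S k + 1)%nat with (k + 2)%nat by lia.
  replace (S k) with (k + 1)%nat by lia.
  apply (path_cube_next N); auto; [lia|apply IH; lia].
Qed.

Lemma path_cube_inside (N : nat) (P : nat -> point) (k j : nat) :
  straight_drawing N (path_cube N) P -> (k + 3 <= j)%nat -> (j < N)%nat ->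
  inside (P 0%nat) (P 1%nat) (P 2%nat) (P 3%nat) ->
  inside (P k) (P (k + 1)%nat) (P (k + 2)%nat) (P j).
Proof.
  intros HD Hkj Hj H0.
  assert (Hd : exists d, j = (k + 3 + d)%nat) by (exists (j - (k + 3))%nat; lia).
  destruct Hd as [d ->]. clear Hkj. revert k Hj.
  induction d as [|d IH]; intros k Hj.
  - replace (k + 3 + 0)%nat with (k + 3)%nat by lia.
    apply (path_cube_nested N); auto; lia.
  - apply inside_trans with (P (k + 3)%nat).
    + apply (path_cube_nested N); auto; lia.
    + replace (k + 3)%nat with (k + 1 + 2)%nat at 1 by lia.
      replace (k + 2)%nat with (k + 1 + 1)%nat by lia.
      replace (k + 3 + S d)%nat with (k + 1 + 3 + d)%nat by lia.
      apply IH; lia.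
Qed.

Lemma path_cube_orientation (N : nat) (P : nat -> point) (k : nat) :
  straight_drawing N (path_cube N) P -> (k + 3 < N)%nat ->
  inside (P 0%nat) (P 1%nat) (P 2%nat) (P 3%nat) ->
  exists t, 0 < t /\
    det (P k) (P (k + 1)%nat) (P (k + 2)%nat) = t * det (P 0%nat) (P 1%nat) (P 2%nat).
Proof.
  intros HD Hk H0; induction k as [|k IH]; [exists 1; split; [lra|simpl; ring]|].
  destruct IH as (t & Ht & e); [lia|].
  destruct (inside_det _ _ _ _ (path_cube_nested N P k HD ltac:(lia) H0)) as (u & Hu & e').
  exists (u * t); split; [nra|].
  rewrite Rmult_assoc, <- e, <- e'.
  replace (S k + 2)%nat with (k + 3)%nat by lia.
  replace (S k + 1)%nat with (k + 2)%nat by lia.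
  replace (S k) with (k + 1)%nat by lia. reflexivity.
Qed.

(** The injection [f] need not be monotone, so this also covers reading a path backwards. *)
Lemma straight_drawing_restrict (n m : nat) (E E' : nat -> nat -> Prop)
  (pos : nat -> point) (f : nat -> nat) :
  straight_drawing n E pos ->
  (forall i, (i < m)%nat -> (f i < n)%nat) ->
  (forall i j, (i < m)%nat -> (j < m)%nat -> f i = f j -> i = j) ->
  (forall i j, E' i j -> (i < m)%nat /\ (j < m)%nat /\ E (f i) (f j)) ->
  straight_drawing m E' (fun i => pos (f i)).
Proof.
  intros (H1 & H2 & H3) Hf Hinj HE. split; [|split].
  - intros u v Hu Hv e. apply Hinj; auto.
  - intros u v w Huv Hw n1 n2. destruct (HE u v Huv) as (? & ? & ?).
    apply H2; auto.
  - intros u v w x Huv Hwx Hne r h1 h2.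
    destruct (HE u v Huv) as (? & ? & ?), (HE w x Hwx) as (? & ? & ?).
    destruct (H3 (f u) (f v) (f w) (f x)) with (r := r) as (z & Hz1 & Hz2 & Hr); auto.
    { unfold same_edge in *; intros [[e1 e2]|[e1 e2]]; apply Hne; apply Hinj in e1, e2; auto. }
    destruct Hz1 as [-> | ->], Hz2 as [e|e]; apply Hinj in e; auto; subst.
    all: eexists; split; [|split; [|reflexivity]]; auto.
Qed.

(** * Lines in bent position *)

Definition side (l : line) (p : point) : R :=
  let '(a, b, c) := l in a * fst p + b * snd p - c.

Definition cross (l l' : line) : R :=
  let '(a, b, _) := l in let '(a', b', _) := l' in a * b' - b * a'.

(** Minus the determinant of the 3 by 3 matrix of the coefficients. For pairwise crossing lines it
    vanishes exactly when they are concurrent. *)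
Definition bend (l1 l2 l3 : line) : R :=
  snd l2 * cross l1 l3 - snd l1 * cross l2 l3 - snd l3 * cross l1 l2.

(* Up to signs of the equations this says that the lines, taken in order of slope, occur
   in this order on their envelope, which may degenerate to a common point. *)
Definition bent (K : nat) (g : nat -> line) : Prop :=
  (forall i j, (i < j < K)%nat -> 0 < cross (g i) (g j)) /\
  (forall i j k, (i < j)%nat -> (j < k < K)%nat -> 0 <= bend (g i) (g j) (g k)).

Lemma on_line_side (l : line) (p : point) : on_line l p <-> side l p = 0.
Proof. destruct l as [[a b] c]; simpl; lra. Qed.

(** The three normals are linearly dependent, so this combination of the [side] functions is
    constant. At the intersection of [l1] and [l3] it gives the value of [side l2], namely
    [- bend / cross l1 l3]. *)
Lemma bend_side (l1 l2 l3 : line) (p : point) :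
  cross l1 l3 * side l2 p + bend l1 l2 l3 = cross l2 l3 * side l1 p + cross l1 l2 * side l3 p.
Proof.
  destruct l1 as [[a1 b1] c1], l2 as [[a2 b2] c2], l3 as [[a3 b3] c3].
  unfold bend; simpl; ring.
Qed.

(** By [bend_side], the wedge where both outer lines are nonpositive lies on the nonpositive side of
    the middle line. This is all that most sign arguments below use of [bent]. *)
Lemma bent_middle_le (K : nat) (g : nat -> line) (i j k : nat) (p : point) :
  bent K g -> (i < j)%nat -> (j < k < K)%nat ->
  side (g i) p <= 0 -> side (g k) p <= 0 -> side (g j) p <= 0.
Proof.
  intros [H1 H2] Hij Hjk hi hk.
  assert (X := bend_side (g i) (g j) (g k) p).
  assert (Dl := H2 i j k Hij Hjk).
  assert (0 < cross (g i) (g j)) by (apply H1; lia).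
  assert (0 < cross (g i) (g k)) by (apply H1; lia).
  assert (0 < cross (g j) (g k)) by (apply H1; lia).
  nra.
Qed.

Lemma bent_middle_lt (K : nat) (g : nat -> line) (i j k : nat) (p : point) :
  bent K g -> (i < j)%nat -> (j < k < K)%nat ->
  side (g i) p <= 0 -> side (g k) p <= 0 -> side (g i) p < 0 \/ side (g k) p < 0 ->
  side (g j) p < 0.
Proof.
  intros [H1 H2] Hij Hjk hi hk h.
  assert (X := bend_side (g i) (g j) (g k) p).
  assert (Dl := H2 i j k Hij Hjk).
  assert (0 < cross (g i) (g j)) by (apply H1; lia).
  assert (0 < cross (g i) (g k)) by (apply H1; lia).
  assert (0 < cross (g j) (g k)) by (apply H1; lia).
  destruct h; nra.
Qed.

Lemma side_comb (l : line) (a b c : R) (p q r : point) :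
  a + b + c = 1 ->
  side l (comb a b c p q r) = a * side l p + b * side l q + c * side l r.
Proof.
  destruct l as [[u v] w]; unfold comb; simpl; intros H.
  replace c with (1 - a - b) by lra; ring.
Qed.

Lemma inside_side_neg (l : line) (p q r x : point) :
  inside p q r x -> side l x <= 0 -> 0 < side l p -> side l q < 0 \/ side l r < 0.
Proof.
  intros (a & b & c & Ha & Hb & Hc & Hs & ->). rewrite side_comb; auto. intros h1 h2.
  destruct (Rlt_dec (side l q) 0); [tauto|]. right. nra.
Qed.

(** The map sending [p] to [(side l p, side l' p)] is affine with determinant [cross l l'], so
    orientations can be read off from the two [side] values. *)
Lemma cross_det (l l' : line) (p q r : point) :
  cross l l' * det p q r =
  (side l q - side l p) * (side l' r - side l' p) -
  (side l' q - side l' p) * (side l r - side l p).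
Proof.
  destruct l as [[a1 b1] c1], l' as [[a2 b2] c2]. unfold det; simpl; ring.
Qed.

Lemma ends_positive (K : nat) (g : nat -> line) (a b c : nat) (A B C p : point) :
  bent K g -> (a < b)%nat -> (b < c < K)%nat ->
  side (g a) A = 0 -> side (g b) B = 0 -> side (g c) C = 0 ->
  0 < det A B C -> inside A B C p ->
  0 <= side (g a) p -> 0 <= side (g b) p -> 0 <= side (g c) p ->
  0 < side (g c) A /\ 0 < side (g a) C.
Proof.
  intros [H1 H2] Hab Hbc hA hB hC Hdet (x & y & z & Hx & Hy & Hz & Hs & ->).
  rewrite !side_comb; auto. rewrite hA, hB, hC. intros pa pb pc.
  assert (XA := bend_side (g a) (g b) (g c) A).
  assert (XB := bend_side (g a) (g b) (g c) B).
  assert (XC := bend_side (g a) (g b) (g c) C).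
  rewrite hA in XA. rewrite hB in XB. rewrite hC in XC.
  assert (Dl := H2 a b c Hab Hbc).
  assert (al : 0 < cross (g b) (g c)) by (apply H1; lia).
  assert (be : 0 < cross (g a) (g b)) by (apply H1; lia).
  assert (ga : 0 < cross (g a) (g c)) by (apply H1; lia).
  assert (Hd := cross_det (g a) (g c) A B C). rewrite hA, hC in Hd.
  assert (Hd' : 0 < cross (g a) (g c) * det A B C) by nra.
  revert XA XB XC Dl al be ga Hd Hd' pa pb pc.
  generalize (cross (g b) (g c)) (cross (g a) (g b)) (cross (g a) (g c)) (bend (g a) (g b) (g c)).
  generalize (side (g c) A) (side (g a) C) (side (g b) A) (side (g b) C)
    (side (g a) B) (side (g c) B) (det A B C).
  intros tA sC bA bC sB tB D al be ga de XA XB XC Dl hal hbe hga Hd Hd' pa pb pc.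
  (* If [A] is not positive on line [c], the conditions at [p] and the [bend] identities fix the
     signs one after another until the formula for the determinant is nonpositive. The second half
     is the same with [a] and [c] exchanged. *)
  split.
  - apply Rnot_le_lt; intros h.
    assert (tB0 : 0 <= tB) by nra.
    assert (bA0 : ga * bA <= - de) by nra.
    assert (bA1 : bA <= 0) by nra.
    assert (bC0 : 0 <= bC) by nra.
    assert (sC0 : 0 <= sC) by nra.
    assert (sB <= sC) by nra.
    nra.
  - apply Rnot_le_lt; intros h.
    assert (sB0 : 0 <= sB) by nra.
    assert (bC0 : ga * bC <= - de) by nra.
    assert (bC1 : bC <= 0) by nra.
    assert (bA0 : 0 <= bA) by nra.
    assert (tA0 : 0 <= tA) by nra.
    assert (tB <= tA) by nra.
    nra.
Qed.

(** With [X = al * sB], [Y = al * sC] and [T = be * tA], the scaled determinant is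
    [X * (Y - T) - de * Y + T * Y]. Since [Y < de < T] and [X > de], it is less than [T * (Y - de)],
    which is negative. *)
Lemma far_corner_absurd (al be de tA tB sB sC : R) :
  0 < al -> 0 < be -> 0 <= de -> al * sB + be * tB = de -> tB < 0 ->
  0 < tA -> de < be * tA -> al * sC < de ->
  0 < - sB * tA - tB * sC + tA * sC -> False.
Proof.
  intros Hal Hbe Hde HB HtB HtA HA HC HD.
  assert (0 < al * be * (- sB * tA - tB * sC + tA * sC)) by (apply Rmult_lt_0_compat; nra).
  assert (e : al * be * (- sB * tA - tB * sC + tA * sC) =
    (al * sB) * (al * sC - be * tA) - de * (al * sC) + (be * tA) * (al * sC))
    by (rewrite <- HB; ring).
  assert (0 < be * tA) by nra.
  assert (de < al * sB) by nra.
  revert e H H0 H1 HA HC.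
  generalize (al * be * (- sB * tA - tB * sC + tA * sC)) (al * sB) (al * sC) (be * tA).
  intros; nra.
Qed.

Lemma oriented_triangle_absurd (K : nat) (g : nat -> line) (i0 a i1 b i2 c i3 : nat)
  (A B C y0 y1 y2 y3 p : point) :
  bent K g ->
  (i0 < a)%nat -> (a < i1)%nat -> (i1 < b)%nat -> (b < i2)%nat -> (i2 < c)%nat ->
  (c < i3)%nat -> (i3 < K)%nat ->
  side (g a) A = 0 -> side (g b) B = 0 -> side (g c) C = 0 -> 0 < det A B C ->
  inside A B C y0 -> side (g i0) y0 = 0 -> inside A B C y1 -> side (g i1) y1 = 0 ->
  inside A B C y2 -> side (g i2) y2 = 0 -> inside A B C y3 -> side (g i3) y3 = 0 ->
  inside A B C p ->
  0 <= side (g a) p -> 0 <= side (g b) p -> 0 <= side (g c) p -> False.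
Proof.
  intros Hg L0 L1 L2 L3 L4 L5 L6 hA hB hC Hdet I0 Y0 I1 Y1 I2 Y2 I3 Y3 Ip pa pb pc.
  destruct (ends_positive K g a b c A B C p) as [tA sC]; auto; try lia.
  (* These two facts give nearly every sign below, mostly by contraposition: a corner vanishes on
     its own line, so it cannot be nonpositive on an earlier and a later line and negative on one of
     them. *)
  assert (le := fun i j k q => bent_middle_le K g i j k q Hg).
  assert (lt := fun i j k q => bent_middle_lt K g i j k q Hg).
  assert (A3 : 0 < side (g i3) A).
  { apply Rnot_le_lt; intros h. assert (h' := le a c i3 A ltac:(lia) ltac:(lia)). lra. }
  assert (C0 : 0 < side (g i0) C).
  { apply Rnot_le_lt; intros h. assert (h' := le i0 a c C ltac:(lia) ltac:(lia)). lra. }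
  (* The nested vertex on [i3] forces a corner strictly below that line, since [A] is above it. Each
     of the other nested vertices is used in this way. *)
  destruct (inside_side_neg (g i3) A B C y3) as [B3|C3]; auto; try lra.
  - assert (B0 : 0 <= side (g i0) B).
    { apply Rnot_lt_le; intros h. assert (h' := lt i0 b i3 B ltac:(lia) ltac:(lia)). lra. }
    assert (A0 : side (g i0) A < 0).
    { destruct (inside_side_neg (g i0) C A B y0) as [h|h]; auto; try lra.
      apply inside_rotate, inside_rotate; auto. }
    assert (A1 : 0 < side (g i1) A).
    { apply Rnot_le_lt; intros h. assert (h' := lt i0 a i1 A ltac:(lia) ltac:(lia)). lra. }
    assert (B1 : 0 < side (g i1) B).
    { apply Rnot_le_lt; intros h. assert (h' := lt i1 b i3 B ltac:(lia) ltac:(lia)). lra. }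
    assert (C1 : side (g i1) C < 0).
    { destruct (inside_side_neg (g i1) A B C y1) as [h|h]; auto; lra. }
    assert (bC : side (g b) C < 0) by (apply (lt i1 b c C); lia || lra).
    assert (cB : side (g c) B < 0) by (apply (lt b c i3 B); lia || lra).
    assert (bA : 0 < side (g b) A).
    { apply Rnot_le_lt; intros h. assert (h' := lt i0 a b A ltac:(lia) ltac:(lia)). lra. }
    (* Now [A] and [C] are strictly separated by line [b], and [B] is negative on line [c];
       [far_corner_absurd] shows that such a triangle is not positively oriented. *)
    clear - Hg L1 L2 L3 L4 L5 L6 hA hB hC Hdet tA sC bC cB bA.
    assert (XA := bend_side (g a) (g b) (g c) A).
    assert (XB := bend_side (g a) (g b) (g c) B).
    assert (XC := bend_side (g a) (g b) (g c) C).
    assert (Hd := cross_det (g a) (g c) A B C).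
    rewrite hA in *. rewrite hB in *. rewrite hC in *.
    destruct Hg as [H1 H2].
    assert (al : 0 < cross (g b) (g c)) by (apply H1; lia).
    assert (be : 0 < cross (g a) (g b)) by (apply H1; lia).
    assert (ga : 0 < cross (g a) (g c)) by (apply H1; lia).
    apply (far_corner_absurd (cross (g b) (g c)) (cross (g a) (g b)) (bend (g a) (g b) (g c))
      (side (g c) A) (side (g c) B) (side (g a) B) (side (g a) C)); nra.
  - destruct (inside_side_neg (g i0) C A B y0) as [A0|B0]; auto; try lra.
    { apply inside_rotate, inside_rotate; auto. }
    (* Here [A] and [C] are positive on both [i1] and [i2], so [B] is negative on both, hence also
       on line [b] between them, which contains it. *)
    + assert (A1 : 0 < side (g i1) A).
      { apply Rnot_le_lt; intros h. assert (h' := lt i0 a i1 A ltac:(lia) ltac:(lia)). lra. }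
      assert (C1 : 0 < side (g i1) C).
      { apply Rnot_le_lt; intros h. assert (h' := lt i1 c i3 C ltac:(lia) ltac:(lia)). lra. }
      assert (A2 : 0 < side (g i2) A).
      { apply Rnot_le_lt; intros h. assert (h' := lt i0 a i2 A ltac:(lia) ltac:(lia)). lra. }
      assert (C2 : 0 < side (g i2) C).
      { apply Rnot_le_lt; intros h. assert (h' := lt i2 c i3 C ltac:(lia) ltac:(lia)). lra. }
      assert (B1 : side (g i1) B < 0).
      { destruct (inside_side_neg (g i1) A B C y1) as [h|h]; auto; lra. }
      assert (B2 : side (g i2) B < 0).
      { destruct (inside_side_neg (g i2) A B C y2) as [h|h]; auto; lra. }
      assert (h' := lt i1 b i2 B ltac:(lia) ltac:(lia)). lra.
    (* The mirror image of the first case, with [a] and [c] exchanged. *)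
    + assert (C2 : 0 < side (g i2) C).
      { apply Rnot_le_lt; intros h. assert (h' := lt i2 c i3 C ltac:(lia) ltac:(lia)). lra. }
      assert (B2 : 0 < side (g i2) B).
      { apply Rnot_le_lt; intros h. assert (h' := lt i0 b i2 B ltac:(lia) ltac:(lia)). lra. }
      assert (A2 : side (g i2) A < 0).
      { destruct (inside_side_neg (g i2) B C A y2) as [h|h]; auto; try lra.
        apply inside_rotate; auto. }
      assert (bA : side (g b) A < 0) by (apply (lt a b i2 A); lia || lra).
      assert (aB : side (g a) B < 0) by (apply (lt i0 a b B); lia || lra).
      assert (bC : 0 < side (g b) C).
      { apply Rnot_le_lt; intros h. assert (h' := lt b c i3 C ltac:(lia) ltac:(lia)). lra. }
      clear - Hg L1 L2 L3 L4 L5 L6 hA hB hC Hdet tA sC bC aB bA.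
      assert (XA := bend_side (g a) (g b) (g c) A).
      assert (XB := bend_side (g a) (g b) (g c) B).
      assert (XC := bend_side (g a) (g b) (g c) C).
      assert (Hd := cross_det (g a) (g c) A B C).
      rewrite hA in *. rewrite hB in *. rewrite hC in *.
      destruct Hg as [H1 H2].
      assert (al : 0 < cross (g b) (g c)) by (apply H1; lia).
      assert (be : 0 < cross (g a) (g b)) by (apply H1; lia).
      assert (ga : 0 < cross (g a) (g c)) by (apply H1; lia).
      apply (far_corner_absurd (cross (g a) (g b)) (cross (g b) (g c)) (bend (g a) (g b) (g c))
        (side (g a) C) (side (g a) B) (side (g c) B) (side (g c) A)); nra.
Qed.

(** * A nested path on 17 homogeneous lines *)

Definition parallel (K : nat) (g : nat -> line) : Prop :=
  exists (a b : R) (q : nat -> R),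
    (forall i p, (i < K)%nat -> on_line (g i) p -> a * fst p + b * snd p = q i) /\
    ((forall i j, (i < j < K)%nat -> q i < q j) \/ (forall i j, (i < j < K)%nat -> q j < q i)).

Lemma nonzero_sign (x : R) : x <> 0 -> 0 < x \/ 0 < - x.
Proof. intros; destruct (Rtotal_order x 0); lra. Qed.

(* Each point of line [i] lies on the negative side only of lines between [i] and some
   other index, hence only on one side of [i]. *)
Lemma bent_one_sided (K : nat) (g : nat -> line) (i : nat) (p : point) :
  bent K g -> (i < K)%nat -> side (g i) p = 0 ->
  (forall j, (j < i)%nat -> 0 <= side (g j) p) \/
  (forall j, (i < j < K)%nat -> 0 <= side (g j) p).
Proof.
  intros Hg Hi hi.
  destruct (classic (exists j, (j < i)%nat /\ side (g j) p < 0)) as [(j & Hj & hj)|Hn].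
  - right. intros k Hk. apply Rnot_lt_le; intros hk.
    assert (h := bent_middle_lt K g j i k p Hg).
    assert (side (g i) p < 0) by (apply h; lia || lra). lra.
  - left. intros j Hj. apply Rnot_lt_le; intros hj. apply Hn; eauto.
Qed.

(* The first eight entries are the lines of the vertices used in oriented triangles, the
   even ones those of vertices nested inside all of these triangles. The consecutive
   triples (1,3,7) and (3,7,5) are oriented oppositely with respect to the line order, and
   so are (9,11,15) and (11,15,13). *)
Definition nested_order : list nat :=
  [1; 3; 7; 5; 9; 11; 15; 13; 0; 2; 4; 6; 8; 10; 12; 14; 16]%nat.

Lemma nested_path_absurd (g : nat -> line) (P : nat -> point) :
  bent 17 g \/ parallel 17 g ->
  straight_drawing 17 (path_cube 17) P ->
  inside (P 0%nat) (P 1%nat) (P 2%nat) (P 3%nat) ->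
  (forall j, (j < 17)%nat -> on_line (g (nth j nested_order 0%nat)) (P j)) -> False.
Proof.
  intros Hg HD H0 Hon.
  assert (Hin := fun k j => path_cube_inside 17 P k j HD).
  destruct Hg as [Hg|(a & b & q & Hq & Hmon)].
  - assert (Hs : forall j, (j < 17)%nat -> side (g (nth j nested_order 0%nat)) (P j) = 0)
      by (intros; apply on_line_side; auto).
    assert (S0 := Hs 0%nat ltac:(lia)); assert (S1 := Hs 1%nat ltac:(lia));
    assert (S2 := Hs 2%nat ltac:(lia)); assert (S3 := Hs 3%nat ltac:(lia));
    assert (S4 := Hs 4%nat ltac:(lia)); assert (S5 := Hs 5%nat ltac:(lia));
    assert (S6 := Hs 6%nat ltac:(lia)); assert (S7 := Hs 7%nat ltac:(lia));
    assert (S8 := Hs 8%nat ltac:(lia)); assert (S9 := Hs 9%nat ltac:(lia));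
    assert (S10 := Hs 10%nat ltac:(lia)); assert (S11 := Hs 11%nat ltac:(lia));
    assert (S12 := Hs 12%nat ltac:(lia)); assert (S13 := Hs 13%nat ltac:(lia));
    assert (S14 := Hs 14%nat ltac:(lia)); assert (S15 := Hs 15%nat ltac:(lia));
    assert (S16 := Hs 16%nat ltac:(lia)).
    simpl in S0, S1, S2, S3, S4, S5, S6, S7, S8, S9, S10, S11, S12, S13, S14, S15, S16.
    assert (Hdet : det (P 0%nat) (P 1%nat) (P 2%nat) <> 0).
    { apply (triangle_noncollinear 17 (path_cube 17)); auto; try lia; unfold path_cube; lia. }
    assert (Hor := fun k => path_cube_orientation 17 P k HD).
    destruct (bent_one_sided 17 g 8 (P 12%nat) Hg ltac:(lia) S12) as [Hp|Hp];
    destruct (nonzero_sign _ Hdet) as [Hpos|Hneg].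
    + apply (oriented_triangle_absurd 17 g 0 1 2 3 4 7 8 (P 0%nat) (P 1%nat) (P 2%nat)
        (P 8%nat) (P 9%nat) (P 10%nat) (P 12%nat) (P 12%nat)); auto; try lia;
        try (apply (Hin 0%nat); auto; lia); apply Hp; lia.
    + destruct (Hor 1%nat ltac:(lia) H0) as (t & Ht & e). simpl in e.
      apply (oriented_triangle_absurd 17 g 0 3 4 5 6 7 8 (P 1%nat) (P 3%nat) (P 2%nat)
        (P 8%nat) (P 10%nat) (P 11%nat) (P 12%nat) (P 12%nat)); auto; try lia;
        try (apply inside_rotate, inside_swap, (Hin 1%nat); auto; lia); try (apply Hp; lia).
      rewrite det_swap; nra.
    + destruct (Hor 4%nat ltac:(lia) H0) as (t & Ht & e). simpl in e.
      apply (oriented_triangle_absurd 17 g 8 9 10 11 12 15 16 (P 4%nat) (P 5%nat) (P 6%nat)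
        (P 12%nat) (P 13%nat) (P 14%nat) (P 16%nat) (P 12%nat)); auto; try lia;
        try (apply (Hin 4%nat); auto; lia); try (apply Hp; lia).
      nra.
    + destruct (Hor 5%nat ltac:(lia) H0) as (t & Ht & e). simpl in e.
      apply (oriented_triangle_absurd 17 g 8 11 12 13 14 15 16 (P 5%nat) (P 7%nat) (P 6%nat)
        (P 12%nat) (P 14%nat) (P 15%nat) (P 16%nat) (P 12%nat)); auto; try lia;
        try (apply inside_rotate, inside_swap, (Hin 5%nat); auto; lia); try (apply Hp; lia).
      rewrite det_swap; nra.
  - destruct (Hin 0%nat 8%nat) as (x & y & z & Hx & Hy & Hz & Hsum & e); auto; try lia.
    simpl in e.
    assert (Hq' : forall j, (j < 17)%nat ->
      a * fst (P j) + b * snd (P j) = q (nth j nested_order 0%nat)).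
    { intros j Hj. apply Hq; [|auto]. do 17 (destruct j as [|j]; [simpl; lia|]). lia. }
    assert (Q0 := Hq' 0%nat ltac:(lia)).
    assert (Q1 := Hq' 1%nat ltac:(lia)).
    assert (Q2 := Hq' 2%nat ltac:(lia)).
    assert (Q8 := Hq' 8%nat ltac:(lia)).
    rewrite e in Q8. unfold comb in Q8. simpl in Q0, Q1, Q2, Q8.
    assert (Hc : q 0%nat = x * q 1%nat + y * q 3%nat + z * q 7%nat)
      by (rewrite <- Q0, <- Q1, <- Q2, <- Q8; ring).
    replace x with (1 - y - z) in Hc, Hx by lra.
    assert (Hz0 : (1 - y - z) * (q 1%nat - q 0%nat) + y * (q 3%nat - q 0%nat) +
      z * (q 7%nat - q 0%nat) = 0) by lra.
    destruct Hmon as [Hm|Hm];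
      assert (h1 := Hm 0%nat 1%nat ltac:(lia)); assert (h3 := Hm 0%nat 3%nat ltac:(lia));
      assert (h7 := Hm 0%nat 7%nat ltac:(lia)).
    all: clear - h1 h3 h7 Hx Hy Hz Hz0; nra.
Qed.

(** * Planarity of the cube of a path *)

Definition hull (p q r x : point) : Prop :=
  exists a b c, 0 <= a /\ 0 <= b /\ 0 <= c /\ a + b + c = 1 /\ x = comb a b c p q r.

Lemma on_seg_sym (p q r : point) : on_seg p q r -> on_seg q p r.
Proof.
  intros (t & Ht & ->). exists (1 - t); split; [lra|]. f_equal; ring.
Qed.

Lemma hull_seg (p q r x y z : point) :
  hull p q r x -> hull p q r y -> on_seg x y z -> hull p q r z.
Proof.
  intros (a & b & c & Ha & Hb & Hc & H1 & ->) (a' & b' & c' & Ha' & Hb' & Hc' & H1' & ->)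
    (t & Ht & ->).
  exists (a + t * (a' - a)), (b + t * (b' - b)), (c + t * (c' - c)).
  repeat split; try nra. unfold comb; simpl; f_equal; ring.
Qed.

Lemma comb_inj (p q r : point) (a b c a' b' c' : R) :
  det p q r <> 0 -> a + b + c = 1 -> a' + b' + c' = 1 ->
  comb a b c p q r = comb a' b' c' p q r -> a = a' /\ b = b' /\ c = c'.
Proof.
  destruct p as [p1 p2], q as [q1 q2], r as [r1 r2]; unfold det, comb; simpl.
  intros Hd H1 H2 e. injection e as e1 e2.
  replace a with (1 - b - c) in * by lra. replace a' with (1 - b' - c') in * by lra.
  assert (f1 : (b - b') * (q1 - p1) + (c - c') * (r1 - p1) = 0) by lra.
  assert (f2 : (b - b') * (q2 - p2) + (c - c') * (r2 - p2) = 0) by lra.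
  assert (h : (b - b') * ((q1 - p1) * (r2 - p2) - (q2 - p2) * (r1 - p1)) = 0).
  { replace ((b - b') * ((q1 - p1) * (r2 - p2) - (q2 - p2) * (r1 - p1))) with
    (((b - b') * (q1 - p1) + (c - c') * (r1 - p1)) * (r2 - p2) -
     ((b - b') * (q2 - p2) + (c - c') * (r2 - p2)) * (r1 - p1)) by ring.
    rewrite f1, f2; ring. }
  assert (h' : (c - c') * ((q1 - p1) * (r2 - p2) - (q2 - p2) * (r1 - p1)) = 0).
  { replace ((c - c') * ((q1 - p1) * (r2 - p2) - (q2 - p2) * (r1 - p1))) with
    (((b - b') * (q2 - p2) + (c - c') * (r2 - p2)) * (q1 - p1) -
     ((b - b') * (q1 - p1) + (c - c') * (r1 - p1)) * (q2 - p2)) by ring.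
    rewrite f1, f2; ring. }
  apply Rmult_integral in h, h'. lra.
Qed.

(** Relative to [p q r], the point [s] has negative weights at [q] and [r], while [v] has weight
    zero at one of them. That weight stays negative along the segment until [v] is reached. *)
Lemma apex_seg_hull (p q r s v x : point) :
  det p q r <> 0 -> inside q r s p -> v = p \/ v = q \/ v = r ->
  on_seg s v x -> hull p q r x -> x = v.
Proof.
  intros Hd (a & b & c & Ha & Hb & Hc & H1 & Hp) Hv (t & Ht & Hx)
    (a' & b' & c' & Ha' & Hb' & Hc' & H1' & Hx').
  assert (Hi : 0 < / c) by (apply Rinv_0_lt_compat; lra).
  assert (Hy : - a * / c < 0) by nra. assert (Hz : - b * / c < 0) by nra.
  assert (Hsum : / c + (- a * / c) + (- b * / c) = 1)
    by (replace b with (1 - a - c) by lra; field; lra).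
  assert (Hs : s = comb (/ c) (- a * / c) (- b * / c) p q r).
  { destruct p as [p1 p2], q as [q1 q2], r as [r1 r2], s as [s1 s2].
    unfold comb in *; simpl in *. injection Hp as -> ->. f_equal; field; lra. }
  revert Hs Hsum Hy Hz. generalize (/ c) (- a * / c) (- b * / c).
  intros X Y Z Hs Hsum Hy Hz.
  assert (Hend : t = 1 -> x = v).
  { intros ->. rewrite Hx. destruct v as [v1 v2]; simpl; f_equal; ring. }
  apply Hend.
  assert (He : exists u v' w, u + v' + w = 1 /\ (v' = 0 \/ w = 0) /\ v = comb u v' w p q r).
  { destruct Hv as [->|[->| ->]]; [exists 1, 0, 0|exists 0, 1, 0|exists 0, 0, 1];
    (split; [lra|]; split; [lra|]);
    destruct p, q, r; unfold comb; simpl; f_equal; ring. }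
  destruct He as (u & v' & w & Huvw & H0 & Hv').
  assert (E : comb (X + t * (u - X)) (Y + t * (v' - Y)) (Z + t * (w - Z)) p q r =
    comb a' b' c' p q r).
  { rewrite <- Hx', Hx, Hs, Hv'. unfold comb; simpl; f_equal; ring. }
  apply comb_inj in E; auto; [|nra].
  destruct E as (_ & E1 & E2).
  destruct H0 as [-> | ->]; nra.
Qed.

(** The planar drawing is built from the inside out, so here later triangles contain all earlier
    vertices. *)
Lemma nested_vertex_in_hull (P : nat -> point) :
  (forall k, inside (P (k + 1)%nat) (P (k + 2)%nat) (P (k + 3)%nat) (P k)) ->
  forall k j, (j <= k + 2)%nat -> hull (P k) (P (k + 1)%nat) (P (k + 2)%nat) (P j).
Proof.
  intros Hin k j Hj.
  assert (Hs : forall d, inside (P (j + d + 1)%nat) (P (j + d + 2)%nat) (P (j + d + 3)%nat) (P j)).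
  { induction d as [|d IH].
    - replace (j + 0)%nat with j by lia. apply Hin.
    - replace (j + S d + 1)%nat with (j + d + 2)%nat by lia.
      replace (j + S d + 2)%nat with (j + d + 3)%nat by lia.
      assert (h := Hin (j + d + 1)%nat).
      replace (j + d + 1 + 1)%nat with (j + d + 2)%nat in h by lia.
      replace (j + d + 1 + 2)%nat with (j + d + 3)%nat in h by lia.
      replace (j + d + 1 + 3)%nat with (j + S d + 3)%nat in h by lia.
      assert (inside (P (j + S d + 3)%nat) (P (j + d + 2)%nat) (P (j + d + 3)%nat) (P j));
        [|inside_perm].
      apply inside_trans with (P (j + d + 1)%nat); inside_perm. }
  destruct (Nat.lt_ge_cases j k) as [h|h].
  - assert (h' := Hs (k - j - 1)%nat).
    replace (j + (k - j - 1) + 1)%nat with k in h' by lia.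
    replace (j + (k - j - 1) + 2)%nat with (k + 1)%nat in h' by lia.
    replace (j + (k - j - 1) + 3)%nat with (k + 2)%nat in h' by lia.
    destruct h' as (a & b & c & Ha & Hb & Hc & H1 & H2).
    exists a, b, c; repeat split; auto; lra.
  - assert (e : j = k \/ j = (k + 1)%nat \/ j = (k + 2)%nat) by lia.
    destruct e as [->|[->| ->]]; [exists 1, 0, 0|exists 0, 1, 0|exists 0, 0, 1];
      repeat split; try lra;
      unfold comb; rewrite (surjective_pairing (P _)) at 1; f_equal; ring.
Qed.

(* The shift by 3 gives every drawn vertex a preceding triangle, whose hull contains all
   earlier vertices. *)
Lemma nested_straight_drawing (N : nat) (P : nat -> point) :
  (forall k, inside (P (k + 1)%nat) (P (k + 2)%nat) (P (k + 3)%nat) (P k)) ->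
  (forall k, det (P k) (P (k + 1)%nat) (P (k + 2)%nat) <> 0) ->
  straight_drawing N (path_cube N) (fun i => P (i + 3)%nat).
Proof.
  intros Hin Hdet.
  assert (Hhull := nested_vertex_in_hull P Hin).
  assert (Hout : forall k, ~ hull (P k) (P (k + 1)%nat) (P (k + 2)%nat) (P (k + 3)%nat)).
  { intros k Hk.
    assert (Hs : forall q, on_seg (P (k + 3)%nat) q (P (k + 3)%nat)).
    { intros q. exists 0; split; [lra|]. destruct (P (k + 3)%nat); simpl; f_equal; ring. }
    assert (e1 := apex_seg_hull _ _ _ _ (P k) _ (Hdet k) (Hin k) ltac:(auto) (Hs _) Hk).
    assert (e2 := apex_seg_hull _ _ _ _ (P (k + 1)%nat) _ (Hdet k) (Hin k) ltac:(auto) (Hs _) Hk).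
    apply (Hdet k). rewrite <- e1, <- e2. unfold det; ring. }
  assert (Hmeet : forall u v j j' x, (v < u)%nat -> (u <= v + 3)%nat -> (3 <= u)%nat ->
    (j < u)%nat -> (j' < u)%nat -> on_seg (P u) (P v) x -> on_seg (P j) (P j') x -> x = P v).
  { intros u v j j' x H1 H2 H3 H4 H5 Hs Hs'.
    assert (hk : exists k, u = (k + 3)%nat) by (exists (u - 3)%nat; lia). destruct hk as [k ->].
    apply (apex_seg_hull (P k) (P (k + 1)%nat) (P (k + 2)%nat) (P (k + 3)%nat)); auto.
    - assert (e : v = k \/ v = (k + 1)%nat \/ v = (k + 2)%nat) by lia.
      destruct e as [->|[->| ->]]; auto.
    - apply (hull_seg _ _ _ (P j) (P j')); auto; apply Hhull; lia. }
  assert (Hseg : forall p, on_seg p p p).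
  { intros [p1 p2]. exists 0; split; [lra|]. simpl; f_equal; ring. }
  assert (Hinj : forall u v, (3 <= u)%nat -> (v < u)%nat -> P u <> P v).
  { intros u v Hu Hv e.
    apply (Hout (u - 3)%nat). replace (u - 3 + 3)%nat with u by lia.
    rewrite e. apply Hhull; lia. }
  assert (Hinj' : forall u v, (3 <= u)%nat -> (3 <= v)%nat -> P u = P v -> u = v).
  { intros u v Hu Hv e. destruct (Nat.lt_trichotomy u v) as [h|[h|h]]; auto; exfalso.
    - apply (Hinj v u); auto.
    - apply (Hinj u v); auto. }
  assert (Havoid : forall u v w, (3 <= v)%nat -> (v < u)%nat -> (u <= v + 3)%nat -> (3 <= w)%nat ->
    w <> u -> w <> v -> ~ on_seg (P u) (P v) (P w)).
  { intros u v w H1 H2 H3 H4 n1 n2 Hs.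
    destruct (Nat.lt_ge_cases w u) as [h|h].
    - apply n2, Hinj'; auto. apply (Hmeet u v w w); auto; lia.
    - apply (Hout (w - 3)%nat).
      apply (hull_seg _ _ _ (P u) (P v)); try (apply Hhull; lia).
      replace (w - 3 + 3)%nat with w by lia; auto. }
  assert (Havoid' : forall u v w, (3 <= u)%nat -> (3 <= v)%nat -> u <> v -> (v <= u + 3)%nat ->
     (u <= v + 3)%nat -> (3 <= w)%nat -> w <> u -> w <> v -> ~ on_seg (P u) (P v) (P w)).
  { intros u v w H1 H2 H3 H4 H5 H6 n1 n2 Hs.
    destruct (Nat.lt_ge_cases v u) as [h|h].
    - apply (Havoid u v w); auto.
    - apply on_seg_sym in Hs. apply (Havoid v u w) in Hs; auto; lia. }
  assert (Hcross : forall u v w x r, (3 <= v)%nat -> (v < u)%nat -> (u <= v + 3)%nat ->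
    (3 <= x)%nat -> (x < w)%nat -> (w <= x + 3)%nat -> ~ (u = w /\ v = x) ->
    on_seg (P u) (P v) r -> on_seg (P w) (P x) r ->
    exists z, (z = u \/ z = v) /\ (z = w \/ z = x) /\ (3 <= z)%nat /\ r = P z).
  { assert (Hlt : forall u v w x r, (3 <= v)%nat -> (v < u)%nat -> (u <= v + 3)%nat ->
    (3 <= x)%nat -> (x < w)%nat -> (w <= x + 3)%nat -> (w < u)%nat ->
    on_seg (P u) (P v) r -> on_seg (P w) (P x) r ->
    exists z, (z = u \/ z = v) /\ (z = w \/ z = x) /\ (3 <= z)%nat /\ r = P z).
    { intros u v w x r H1 H2 H3 H4 H5 H6 H7 Hs Hs'.
      assert (e : r = P v) by (apply (Hmeet u v w x); auto; lia).
      exists v; repeat split; auto. subst r.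
      apply NNPP; intros hn. apply (Havoid w x v); auto. }
    intros u v w x r H1 H2 H3 H4 H5 H6 H7 Hs Hs'.
    destruct (Nat.lt_trichotomy u w) as [h|[h|h]].
    - destruct (Hlt w x u v r) as (z & Hz); auto. exists z; tauto.
    (* Two edges with the same later end [u]: the three ends are not collinear, so unique
       barycentric coordinates leave only [u] in common. *)
    - subst w. exists u; repeat split; auto; [lia|].
      assert (Hd : det (P u) (P v) (P x) <> 0).
      { intros Hd. destruct (collinear_between _ _ _ Hd) as [h|[h|h]]; revert h.
        - apply Havoid'; lia.
        - apply Havoid'; lia.
        - apply Havoid'; lia. }
      destruct Hs as (t & Ht & Hr), Hs' as (s & Hs & Hr').
      assert (e : comb (1 - t) t 0 (P u) (P v) (P x) = comb (1 - s) 0 s (P u) (P v) (P x)).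
      { transitivity r; [rewrite Hr|rewrite Hr']; unfold comb; f_equal; ring. }
      apply comb_inj in e; auto; try lra.
      destruct e as (_ & -> & _). rewrite Hr.
      destruct (P u); simpl; f_equal; ring.
    - apply (Hlt u v w x); auto. }
  split; [|split].
  - intros u v Hu Hv e. apply Hinj' in e; lia.
  - intros u v w (Hu & Hv & Hne & h1 & h2) Hw n1 n2.
    apply Havoid'; lia.
  - intros u v w x (Hu & Hv & Hne & h1 & h2) (Hw & Hx & Hne' & h3 & h4) Hse r Hs Hs'.
    unfold same_edge in Hse.
    assert (Hc : forall u' v' w' x', (u' = u /\ v' = v) \/ (u' = v /\ v' = u) ->
      (w' = w /\ x' = x) \/ (w' = x /\ x' = w) -> (v' < u')%nat -> (x' < w')%nat ->
      exists z, (z = u \/ z = v) /\ (z = w \/ z = x) /\ r = P (z + 3)%nat).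
    { intros u' v' w' x' Hu' Hw' l1 l2.
      destruct (Hcross (u' + 3) (v' + 3) (w' + 3) (x' + 3) r)%nat
        as (z & Hz1 & Hz2 & Hz3 & Hz4); try lia.
      - destruct Hu' as [[-> ->]|[-> ->]]; auto using on_seg_sym.
      - destruct Hw' as [[-> ->]|[-> ->]]; auto using on_seg_sym.
      - exists (z - 3)%nat. replace (z - 3 + 3)%nat with z by (clear - Hz3; lia).
        split; [clear - Hu' Hz1; lia|split; [clear - Hw' Hz2; lia|auto]]. }
    destruct (Nat.lt_ge_cases v u), (Nat.lt_ge_cases x w).
    + apply (Hc u v w x); auto.
    + apply (Hc u v x w); auto; lia.
    + apply (Hc v u w x); auto; lia.
    + apply (Hc v u x w); auto; lia.
Qed.

(* Triples of consecutive points of a sequence in which each point is the centroid of the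
   next three. *)
Fixpoint spiral_triangle (k : nat) : point * point * point :=
  match k with
  | O => ((0, 0), (1, 0), (0, 1))
  | S k => let '(p, q, r) := spiral_triangle k in
           (q, r, (3 * fst p - fst q - fst r, 3 * snd p - snd q - snd r))
  end.

Definition spiral (k : nat) : point := fst (fst (spiral_triangle k)).

Lemma spiral_triangle_eq (k : nat) :
  spiral_triangle k = (spiral k, spiral (k + 1), spiral (k + 2)).
Proof.
  replace (k + 1)%nat with (S k) by lia. replace (k + 2)%nat with (S (S k)) by lia.
  unfold spiral; simpl. destruct (spiral_triangle k) as [[p q] r]; reflexivity.
Qed.

Lemma spiral_step (k : nat) :
  spiral (k + 3) = (3 * fst (spiral k) - fst (spiral (k + 1)) - fst (spiral (k + 2)),
                    3 * snd (spiral k) - snd (spiral (k + 1)) - snd (spiral (k + 2))).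
Proof.
  assert (e := spiral_triangle_eq k). assert (e' := spiral_triangle_eq (k + 1)).
  replace (k + 1)%nat with (S k) in e' at 1 by lia. simpl in e'. rewrite e in e'.
  apply (f_equal snd) in e'. simpl in e'. rewrite e'. f_equal; lia.
Qed.

Lemma spiral_inside (k : nat) :
  inside (spiral (k + 1)) (spiral (k + 2)) (spiral (k + 3)) (spiral k).
Proof.
  exists (/ 3), (/ 3), (/ 3). repeat split; try lra.
  rewrite spiral_step. destruct (spiral k). unfold comb; simpl; f_equal; field.
Qed.

Lemma spiral_det (k : nat) : det (spiral k) (spiral (k + 1)) (spiral (k + 2)) <> 0.
Proof.
  induction k as [|k IH].
  - unfold det; simpl; lra.
  - replace (S k + 2)%nat with (k + 3)%nat by lia.
    replace (S k + 1)%nat with (k + 2)%nat by lia.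
    replace (S k) with (k + 1)%nat by lia. rewrite spiral_step.
    intros h. apply IH. unfold det in *; simpl in *. lra.
Qed.

Lemma straight_drawing_planar (n : nat) (E : nat -> nat -> Prop) (pos : nat -> point) :
  (forall u v, E u v -> (u < n)%nat /\ (v < n)%nat) ->
  straight_drawing n E pos -> planar n E.
Proof.
  intros HE (H1 & H2 & H3).
  set (arc := fun u v t => (fst (pos u) + t * (fst (pos v) - fst (pos u)),
                            snd (pos u) + t * (snd (pos v) - snd (pos u)))).
  assert (Harc : forall u v r, on_arc (arc u v) r -> on_seg (pos u) (pos v) r)
    by (intros u v r (t & Ht & <-); exists t; auto).
  exists pos, arc. split; [exact H1|split; [|split]].
  - intros u v Huv Hlt. destruct (HE u v Huv) as [Hu Hv].
    assert (Hne : pos u <> pos v) by (intros e; apply H1 in e; auto; lia).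
    unfold arc; destruct (pos u) as [a b], (pos v) as [c d]; simpl. split; [|split; [|split]].
    + intros t Ht eps Heps.
      set (M := Rabs (c - a) + Rabs (d - b) + 1).
      assert (Ha := Rabs_pos (c - a)). assert (Hb := Rabs_pos (d - b)).
      assert (Hi : 0 < / M) by (apply Rinv_0_lt_compat; unfold M; lra).
      exists (eps * / M). split; [nra|]. intros s Hs Hst. simpl.
      assert (Hlip : forall k, Rabs k < M -> Rabs (s - t) * Rabs k < eps).
      { intros k Hk. assert (0 <= Rabs k) by apply Rabs_pos.
        assert (e : eps * / M * M = eps) by (field; unfold M; lra).
        assert (0 <= Rabs (s - t)) by apply Rabs_pos. nra. }
      split.
      * replace (a + s * (c - a) - (a + t * (c - a))) with ((s - t) * (c - a)) by ring.
        rewrite Rabs_mult. apply Hlip; unfold M; lra.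
      * replace (b + s * (d - b) - (b + t * (d - b))) with ((s - t) * (d - b)) by ring.
        rewrite Rabs_mult. apply Hlip; unfold M; lra.
    + f_equal; ring.
    + f_equal; ring.
    + intros s t _ _ e. injection e as e1 e2.
      assert (f1 : (s - t) * (c - a) = 0) by lra. assert (f2 : (s - t) * (d - b) = 0) by lra.
      apply Rmult_integral in f1, f2.
      destruct f1 as [f1|f1]; [lra|]. destruct f2 as [f2|f2]; [lra|].
      exfalso; apply Hne; f_equal; lra.
  - intros u v w Huv Hlt Hw n1 n2 h. apply (H2 u v w); auto.
  - intros u v w x Huv Hlt Hwx Hlt' Hne r h1 h2.
    apply (H3 u v w x); auto. unfold same_edge; intros [h|[h h']]; [tauto|lia].
Qed.

Lemma bounded_prefix (f : nat -> R) (N : nat) : exists M, forall i, (i < N)%nat -> f i < M.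
Proof.
  induction N as [|N [M IH]].
  - exists 0; intros; lia.
  - exists (Rmax M (f N + 1)). intros i Hi.
    assert (h1 := Rmax_l M (f N + 1)). assert (h2 := Rmax_r M (f N + 1)).
    destruct (Nat.eq_dec i N) as [->|]; [lra|].
    assert (h := IH i ltac:(lia)). lra.
Qed.

Definition embedded (E : nat -> nat -> Prop) (W : nat -> nat) (u v : nat) : Prop :=
  exists i j, E i j /\ u = W i /\ v = W j.

Lemma embedded_straight_drawing (n N : nat) (E : nat -> nat -> Prop) (W : nat -> nat)
  (P : nat -> point) :
  (forall i j, E i j -> (i < N)%nat /\ (j < N)%nat) ->
  (forall i j, (i < N)%nat -> (j < N)%nat -> W i = W j -> i = j) ->
  straight_drawing N E P -> exists pos, straight_drawing n (embedded E W) pos.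
Proof.
  intros HE Hinj (H1 & H2 & H3).
  destruct (bounded_prefix (fun i => fst (P i)) N) as [M HM].
  (* Vertices outside the image of [W] are isolated; they go on the horizontal axis to the right of
     the whole drawing, at distinct abscissas. *)
  set (pos := fun u =>
    match excluded_middle_informative (exists i, (i < N)%nat /\ W i = u) with
    | left h => P (proj1_sig (constructive_indefinite_description _ h))
    | right _ => (M + INR u, 0)
    end).
  assert (Hin : forall i, (i < N)%nat -> pos (W i) = P i).
  { intros i Hi. unfold pos. destruct (excluded_middle_informative _) as [h|h].
    - destruct (constructive_indefinite_description _ h) as (j & Hj & e); simpl.
      f_equal; auto.
    - exfalso; apply h; eauto. }
  assert (Hcase : forall u, (exists i, (i < N)%nat /\ W i = u) \/ pos u = (M + INR u, 0)).
  { intros u. unfold pos. destruct (excluded_middle_informative _); auto. }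
  exists pos. split; [|split].
  - intros u v _ _.
    destruct (Hcase u) as [(i & Hi & <-)|eu], (Hcase v) as [(j & Hj & <-)|ev].
    + rewrite !Hin by auto. intros e. f_equal; auto.
    + rewrite Hin, ev by auto. intros e. assert (h := HM i Hi).
      rewrite e in h. simpl in h. assert (h' := pos_INR v). lra.
    + rewrite Hin, eu by auto. intros e. assert (h := HM j Hj).
      rewrite <- e in h. simpl in h. assert (h' := pos_INR u). lra.
    + rewrite eu, ev. intros e. injection e as e. apply INR_eq. lra.
  - intros u v w (i & j & Hij & -> & ->) _ n1 n2.
    destruct (HE i j Hij) as [Hi Hj]. rewrite !Hin by auto.
    destruct (Hcase w) as [(k & Hk & <-)|ew].
    + rewrite Hin by auto. apply H2; auto; intros ->; auto.
    + rewrite ew. intros (t & Ht & e). injection e as e _.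
      assert (h := HM i Hi). assert (h' := HM j Hj). assert (h'' := pos_INR w). simpl in h, h'.
      destruct (Rle_dec (fst (P i)) (fst (P j))); nra.
  - intros u v w x (i & j & Hij & -> & ->) (k & l & Hkl & -> & ->) Hne r.
    destruct (HE i j Hij) as [Hi Hj]. destruct (HE k l Hkl) as [Hk Hl].
    rewrite !Hin by auto. intros h1 h2.
    destruct (H3 i j k l Hij Hkl) with (r := r) as (z & Hz1 & Hz2 & Hr); auto.
    { unfold same_edge in *. intros [[-> ->]|[-> ->]]; auto. }
    exists (W z). split; [|split].
    + destruct Hz1 as [-> | ->]; auto.
    + destruct Hz2 as [-> | ->]; auto.
    + rewrite Hin; auto. destruct Hz1 as [-> | ->]; auto.
Qed.

(** * Ramsey selection of lines *)

Definition increasing (k : nat) (f : nat -> nat) : Prop :=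
  forall i j, (i < j < k)%nat -> (f i < f j)%nat.

Definition shift_cons {A : Type} (a : A) (f : nat -> A) (i : nat) : A :=
  match i with O => a | S i => f i end.

(** Induction on both sizes: 0 is put in front of the selection for its own class, and the demand on
    that class drops by one. *)
Lemma pigeonhole (a b : nat) (P : nat -> Prop) :
  (exists f, increasing a f /\ forall i, (i < a)%nat -> (f i < a + b)%nat /\ P (f i)) \/
  (exists f, increasing b f /\ forall i, (i < b)%nat -> (f i < a + b)%nat /\ ~ P (f i)).
Proof.
  revert b P. induction a as [|a IHa].
  { left. exists (fun i => i). split; [intros i j; lia|intros i; lia]. }
  induction b as [|b IHb]; intros P.
  { right. exists (fun i => i). split; [intros i j; lia|intros i; lia]. }
  destruct (classic (P 0%nat)) as [h|h].
  - destruct (IHa (S b) (fun i => P (S i))) as [(f & Hf & Hp)|(f & Hf & Hp)].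
    + left. exists (shift_cons 0%nat (fun i => S (f i))). split.
      * intros [|i] [|j] Hij; simpl; try lia. assert (f i < f j)%nat by (apply Hf; lia). lia.
      * intros [|i] Hi; simpl; [split; [lia|auto]|].
        destruct (Hp i ltac:(lia)). split; [lia|auto].
    + right. exists (fun i => S (f i)). split.
      * intros i j Hij. assert (f i < f j)%nat by (apply Hf; lia). lia.
      * intros i Hi. destruct (Hp i Hi). split; [lia|auto].
  - destruct (IHb (fun i => P (S i))) as [(f & Hf & Hp)|(f & Hf & Hp)].
    + left. exists (fun i => S (f i)). split.
      * intros i j Hij. assert (f i < f j)%nat by (apply Hf; lia). lia.
      * intros i Hi. destruct (Hp i Hi). split; [lia|auto].
    + right. exists (shift_cons 0%nat (fun i => S (f i))). split.
      * intros [|i] [|j] Hij; simpl; try lia. assert (f i < f j)%nat by (apply Hf; lia). lia.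
      * intros [|i] Hi; simpl; [split; [lia|auto]|].
        destruct (Hp i ltac:(lia)). split; [lia|auto].
Qed.

(** A finite subset of the indices below [k]; listing it in increasing order lets induction on its
    size peel off the least element. *)
Definition tuple (k : nat) (l : list nat) : Prop :=
  StronglySorted lt l /\ Forall (fun i => (i < k)%nat) l.

Lemma tuple_map (k m : nat) (f : nat -> nat) (l : list nat) :
  increasing k f -> (forall i, (i < k)%nat -> (f i < m)%nat) -> tuple k l -> tuple m (map f l).
Proof.
  intros Hf Hm [Hs Hk]; induction l as [|x l IH].
  - split; constructor.
  - apply StronglySorted_inv in Hs. destruct Hs as [Hs Hx].
    apply Forall_cons_iff in Hk. destruct Hk as [Hxk Hk].
    destruct (IH Hs Hk) as [IH1 IH2]. simpl; split; constructor; auto.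
    apply Forall_map. rewrite Forall_forall in *. intros y Hy. apply Hf; auto.
Qed.

Lemma tuple_shift (k i : nat) (l : list nat) :
  tuple (S k) (i :: l) -> exists l', l = map S l' /\ tuple k l' /\
    (forall i', i = S i' -> tuple k (i' :: l')).
Proof.
  intros [Hs Hk].
  apply StronglySorted_inv in Hs. destruct Hs as [Hs Hx].
  apply Forall_cons_iff in Hk. destruct Hk as [Hxk Hk].
  assert (Ht : forall l, StronglySorted lt l -> Forall (lt i) l ->
    Forall (fun j => (j < S k)%nat) l -> tuple k (map pred l)).
  { clear. induction l as [|x l IH]; intros Hs Hi Hk.
    - split; constructor.
    - apply StronglySorted_inv in Hs. destruct Hs as [Hs Hx].
      apply Forall_cons_iff in Hi, Hk. destruct Hi as [Hi Hi'], Hk as [Hk Hk'].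
      destruct (IH Hs Hi' Hk') as [H1 H2]. split; constructor; auto; [|lia].
      apply Forall_map. rewrite Forall_forall in *. intros y Hy.
      specialize (Hx y Hy). specialize (Hi' y Hy). lia. }
  exists (map pred l). split; [|split; [auto|]].
  - rewrite map_map. rewrite <- map_id at 1. apply map_ext_in. intros y Hy.
    rewrite Forall_forall in Hx. specialize (Hx y Hy). lia.
  - intros i' ->. destruct (Ht l Hs Hx Hk) as [H1 H2]. split; constructor; auto; [|lia].
    apply Forall_map. rewrite Forall_forall in *. intros y Hy. specialize (Hx y Hy). lia.
Qed.

Definition ramsey_number (r k N : nat) : Prop :=
  forall Q : list nat -> Prop, exists f, increasing k f /\
    (forall i, (i < k)%nat -> (f i < N)%nat) /\
    ((forall l, length l = r -> tuple k l -> Q (map f l)) \/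
     (forall l, length l = r -> tuple k l -> ~ Q (map f l))).

(** The Erdős-Rado argument: the colour of a tuple is made to depend only on its least element,
    through [c]. Index 0 is kept as a head, Ramsey for size [r] makes the tails after it
    homogeneous, and the induction continues among those tails. *)
Lemma ramsey_head_determined (r : nat) :
  (forall k, exists N, ramsey_number r k N) ->
  forall k, exists N, forall Q : list nat -> Prop, exists f (c : nat -> Prop),
    increasing k f /\ (forall i, (i < k)%nat -> (f i < N)%nat) /\
    (forall i l, length l = r -> tuple k (i :: l) -> (Q (map f (i :: l)) <-> c i)).
Proof.
  intros HR. induction k as [|k [N IH]].
  { exists 0%nat. intros Q. exists (fun i => i), (fun _ => True).
    split; [intros i j; lia|split; [intros i; lia|]].
    intros i l _ [_ H]. apply Forall_cons_iff in H. lia. }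
  destruct (HR N) as [M HM]. exists (S M). intros Q.
  destruct (HM (fun l => Q (0%nat :: map S l))) as (g & Hg & HgM & Hh).
  destruct (IH (fun l => Q (map (fun i => S (g i)) l))) as (f & c & Hf & HfN & Hc).
  assert (Hc0 : exists c0 : Prop, forall l, length l = r -> tuple N l ->
    (Q (0%nat :: map S (map g l)) <-> c0)).
  { destruct Hh as [h|h]; [exists True|exists False]; intros l H1 H2;
      specialize (h l H1 H2); tauto. }
  destruct Hc0 as [c0 Hc0].
  exists (shift_cons 0%nat (fun i => S (g (f i)))), (shift_cons c0 c). split; [|split].
  - intros [|i] [|j] Hij; simpl; try lia.
    assert (f i < f j)%nat by (apply Hf; lia). assert (f j < N)%nat by (apply HfN; lia).
    assert (g (f i) < g (f j))%nat by (apply Hg; lia). lia.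
  - intros [|i] Hi; simpl; [lia|].
    assert (f i < N)%nat by (apply HfN; lia). specialize (HgM (f i) H). lia.
  - intros i l Hl Ht. destruct (tuple_shift k i l Ht) as (l' & -> & Ht' & Ht'').
    rewrite length_map in Hl. destruct i as [|i].
    + simpl. rewrite <- (Hc0 (map f l')); [|rewrite length_map; auto|apply (tuple_map k); auto].
      rewrite !map_map. reflexivity.
    + simpl. rewrite <- (Hc i l'); [|auto|auto]. simpl. rewrite !map_map. reflexivity.
Qed.

Lemma ramsey (r k : nat) : exists N, ramsey_number r k N.
Proof.
  revert k. induction r as [|r IH]; intros k.
  - exists k. intros Q. exists (fun i => i). split; [intros i j; lia|split; [auto|]].
    destruct (classic (Q nil)) as [h|h]; [left|right]; intros [|x l] Hl; auto; discriminate.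
  - destruct (ramsey_head_determined r IH (k + k)) as [N HN]. exists N. intros Q.
    destruct (HN Q) as (f & c & Hf & HfN & Hc).
    assert (Hcomp : forall g, increasing k g -> (forall i, (i < k)%nat -> (g i < k + k)%nat) ->
      increasing k (fun i => f (g i)) /\ (forall i, (i < k)%nat -> (f (g i) < N)%nat) /\
      (forall l, length l = S r -> tuple k l -> exists i, (i < k)%nat /\
         (Q (map (fun i => f (g i)) l) <-> c (g i)))).
    { intros g Hg Hgk. split; [|split].
      - intros i j Hij. apply Hf. split; [apply Hg|apply Hgk]; lia.
      - auto.
      - intros [|i l] Hl Ht; [discriminate|]. exists i. split.
        + destruct Ht as [_ Ht]. apply Forall_cons_iff in Ht. tauto.
        + rewrite <- (Hc (g i) (map g l)).
          * simpl. rewrite map_map. reflexivity.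
          * rewrite length_map. simpl in Hl; lia.
          * apply (tuple_map k (k + k) g (i :: l)); auto. }
    (* Among [k + k] heads, [k] share a colour, which is then the colour of all tuples on them. *)
    destruct (pigeonhole k k c) as [(g & Hg & Hgc)|(g & Hg & Hgc)];
      destruct (Hcomp g Hg) as (H1 & H2 & H3); try (intros i Hi; apply Hgc; auto);
      exists (fun i => f (g i)); (split; [exact H1|split; [exact H2|]]); [left|right];
      intros l Hl Ht; destruct (H3 l Hl Ht) as (i & Hi & e); rewrite e; apply Hgc; auto.
Qed.

Lemma ramsey_pairs (k : nat) : exists N, forall P : nat -> nat -> Prop, exists f,
  increasing k f /\ (forall i, (i < k)%nat -> (f i < N)%nat) /\
  ((forall i j, (i < j < k)%nat -> P (f i) (f j)) \/
   (forall i j, (i < j < k)%nat -> ~ P (f i) (f j))).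
Proof.
  destruct (ramsey 2 k) as [N HN]. exists N. intros P.
  destruct (HN (fun l => P (nth 0 l 0%nat) (nth 1 l 0%nat))) as (f & Hf & HfN & H).
  exists f. split; [auto|split; [auto|]].
  assert (Ht : forall i j, (i < j < k)%nat -> tuple k [i; j])
    by (intros; split; repeat constructor; lia).
  destruct H as [H|H]; [left|right]; intros i j Hij; apply (H [i; j]); auto.
Qed.

Lemma ramsey_triples (k : nat) : exists N, forall P : nat -> nat -> nat -> Prop, exists f,
  increasing k f /\ (forall i, (i < k)%nat -> (f i < N)%nat) /\
  ((forall i j l, (i < j)%nat -> (j < l < k)%nat -> P (f i) (f j) (f l)) \/
   (forall i j l, (i < j)%nat -> (j < l < k)%nat -> ~ P (f i) (f j) (f l))).
Proof.
  destruct (ramsey 3 k) as [N HN]. exists N. intros P.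
  destruct (HN (fun l => P (nth 0 l 0%nat) (nth 1 l 0%nat) (nth 2 l 0%nat)))
    as (f & Hf & HfN & H).
  exists f. split; [auto|split; [auto|]].
  assert (Ht : forall i j l, (i < j)%nat -> (j < l < k)%nat -> tuple k [i; j; l])
    by (intros; split; repeat constructor; lia).
  destruct H as [H|H]; [left|right]; intros i j l Hij Hjl; apply (H [i; j; l]); auto.
Qed.

Lemma increasing_inj (k : nat) (f : nat -> nat) (i j : nat) :
  increasing k f -> (i < k)%nat -> (j < k)%nat -> f i = f j -> i = j.
Proof.
  intros Hf Hi Hj e. destruct (Nat.lt_trichotomy i j) as [h|[h|h]]; auto.
  - assert (f i < f j)%nat by (apply Hf; lia). lia.
  - assert (f j < f i)%nat by (apply Hf; lia). lia.
Qed.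

(** For [l] parallel to [l0], the normal of [l0] is [s] times that of [l] with
    [s = (a0 * a + b0 * b) / (a * a + b * b)]. The offset [s * c] is thus the constant term of [l]
    rewritten with the normal of [l0]. *)
Definition offset (l0 l : line) : R :=
  let '(a0, b0, _) := l0 in let '(a, b, c) := l in
  (a0 * a + b0 * b) * c / (a * a + b * b).

Lemma parallel_on_line (l0 l : line) (p : point) :
  line_ok l0 -> line_ok l -> cross l0 l = 0 ->
  (on_line l p <-> fst (fst l0) * fst p + snd (fst l0) * snd p = offset l0 l).
Proof.
  destruct l0 as [[a0 b0] c0], l as [[a b] c], p as [x y].
  unfold line_ok, cross, on_line, offset; simpl.
  intros H0 H Hc.
  assert (Hn : 0 < a * a + b * b) by (destruct H; nra).
  assert (Hs : exists s, s <> 0 /\ a0 = s * a /\ b0 = s * b).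
  { exists ((a0 * a + b0 * b) / (a * a + b * b)).
    assert (e1 : a0 = (a0 * a + b0 * b) / (a * a + b * b) * a).
    { apply (Rmult_eq_reg_r (a * a + b * b)); [|lra].
      replace ((a0 * a + b0 * b) / (a * a + b * b) * a * (a * a + b * b))
        with (a0 * (a * a) + b0 * a * b) by (field; lra).
      replace (b0 * a) with (a0 * b) by lra. ring. }
    assert (e2 : b0 = (a0 * a + b0 * b) / (a * a + b * b) * b).
    { apply (Rmult_eq_reg_r (a * a + b * b)); [|lra].
      replace ((a0 * a + b0 * b) / (a * a + b * b) * b * (a * a + b * b))
        with (a0 * b * a + b0 * (b * b)) by (field; lra).
      replace (a0 * b) with (b0 * a) by lra. ring. }
    split; [|auto]. intros e. rewrite e in e1, e2. lra. }
  destruct Hs as (s & Hs & -> & ->).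
  replace ((s * a * a + s * b * b) * c / (a * a + b * b)) with (s * c) by (field; lra).
  split; intros h.
  - rewrite <- h; ring.
  - apply (Rmult_eq_reg_l s); [|auto]. rewrite <- h; ring.
Qed.

Definition opp_line (l : line) : line := let '(a, b, c) := l in (- a, - b, - c).

Lemma on_opp_line (l : line) (p : point) : on_line l p -> on_line (opp_line l) p.
Proof. destruct l as [[a b] c]; simpl; lra. Qed.

Lemma cross_opp (l l' : line) : cross (opp_line l) (opp_line l') = cross l l'.
Proof. destruct l as [[a b] c], l' as [[a' b'] c']; simpl; ring. Qed.

Lemma cross_antisym (l l' : line) : cross l l' = - cross l' l.
Proof. destruct l as [[a b] c], l' as [[a' b'] c']; simpl; ring. Qed.

Lemma bend_opp (l1 l2 l3 : line) :
  bend (opp_line l1) (opp_line l2) (opp_line l3) = - bend l1 l2 l3.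
Proof.
  unfold bend. rewrite !cross_opp.
  destruct l1 as [[a b] c], l2 as [[a' b'] c'], l3 as [[a'' b''] c'']; simpl; ring.
Qed.

(** Ramsey is applied to parallelism of pairs, then to the order of the offsets, or to the sign of
    [cross] and after it that of [bend]. [W] records the chosen lines, and [g] their equations with
    normalised signs. *)
Lemma homogeneous_lines (K : nat) : exists N, forall n L, (N <= n)%nat ->
  (forall i, (i < n)%nat -> line_ok (L i)) ->
  (forall i j, (i < n)%nat -> (j < n)%nat -> i <> j -> distinct_lines (L i) (L j)) ->
  exists (W : nat -> nat) (g : nat -> line),
    (forall i, (i < K)%nat -> (W i < n)%nat) /\
    (forall i j, (i < K)%nat -> (j < K)%nat -> W i = W j -> i = j) /\
    (forall i p, (i < K)%nat -> on_line (L (W i)) p -> on_line (g i) p) /\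
    (bent K g \/ parallel K g).
Proof.
  (* Sizes are fixed in the reverse order of the selections. [N2 + Np] serves either branch, and the
     successor guarantees an index 0, whose normal is the reference in the parallel branch. *)
  destruct (ramsey_triples K) as [N3 H3]. destruct (ramsey_pairs N3) as [N2 H2].
  destruct (ramsey_pairs K) as [Np Hp]. destruct (ramsey_pairs (S (N2 + Np))) as [N H1].
  exists N. intros n L Hn Hok Hdist.
  destruct (H1 (fun i j => cross (L i) (L j) = 0)) as (f1 & Hf1 & HN1 & [Hpar|Hnpar]).
  - assert (Hok1 : forall i, (i < S (N2 + Np))%nat -> line_ok (L (f1 i)))
      by (intros i Hi; apply Hok; specialize (HN1 i Hi); lia).
    assert (Hon : forall i p, (i < S (N2 + Np))%nat -> (on_line (L (f1 i)) p <->
      fst (fst (L (f1 0%nat))) * fst p + snd (fst (L (f1 0%nat))) * snd p =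
      offset (L (f1 0%nat)) (L (f1 i)))).
    { intros i p Hi. apply parallel_on_line; auto; [apply Hok1; lia|].
      destruct i as [|i]; [destruct (L (f1 0%nat)) as [[a b] c]; simpl; ring|].
      apply Hpar; lia. }
    set (q := fun i => offset (L (f1 0%nat)) (L (f1 i))) in *.
    assert (Hq : forall i j, (i < j < S (N2 + Np))%nat -> q i <> q j).
    { intros i j Hij e. assert (f1 i < f1 j)%nat by (apply Hf1; lia).
      apply (Hdist (f1 i) (f1 j)).
      - specialize (HN1 i ltac:(lia)); lia.
      - specialize (HN1 j ltac:(lia)); lia.
      - lia.
      - intros p. rewrite (Hon i), (Hon j) by lia. fold (q i) (q j). rewrite e. reflexivity. }
    destruct (Hp (fun i j => q i < q j)) as (f2 & Hf2 & HN2 & Hmon).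
    exists (fun i => f1 (f2 i)), (fun i => L (f1 (f2 i))). split; [|split; [|split]].
    + intros i Hi. specialize (HN2 i Hi). specialize (HN1 (f2 i) ltac:(lia)). lia.
    + intros i j Hi Hj e.
      apply (increasing_inj K f2); auto. apply (increasing_inj (S (N2 + Np)) f1) in e; auto.
      * specialize (HN2 i Hi); lia.
      * specialize (HN2 j Hj); lia.
    + auto.
    + right. exists (fst (fst (L (f1 0%nat)))), (snd (fst (L (f1 0%nat)))), (fun i => q (f2 i)).
      split.
      * intros i p Hi h. apply Hon; auto. specialize (HN2 i Hi); lia.
      * destruct Hmon as [Hm|Hm]; [left; exact Hm|right].
        intros i j Hij. specialize (Hm i j Hij).
        assert (h : q (f2 i) <> q (f2 j)).
        { apply Hq. assert (f2 i < f2 j)%nat by (apply Hf2; lia).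
          specialize (HN2 j ltac:(lia)); lia. }
        lra.
  - destruct (H2 (fun i j => 0 < cross (L (f1 i)) (L (f1 j)))) as (f2 & Hf2 & HN2 & Hsign).
    assert (Hcomp : exists h : nat -> nat,
      (forall i, (i < N3)%nat -> (h i < n)%nat) /\
      (forall i j, (i < N3)%nat -> (j < N3)%nat -> h i = h j -> i = j) /\
      (forall i j, (i < j < N3)%nat -> 0 < cross (L (h i)) (L (h j)))).
    { assert (Hb : forall i, (i < N3)%nat -> (f1 (f2 i) < n)%nat).
      { intros i Hi. specialize (HN2 i Hi). specialize (HN1 (f2 i) ltac:(lia)). lia. }
      assert (Hi : forall i j, (i < N3)%nat -> (j < N3)%nat -> f1 (f2 i) = f1 (f2 j) -> i = j).
      { intros i j Hi Hj e.
        apply (increasing_inj N3 f2); auto. apply (increasing_inj (S (N2 + Np)) f1) in e; auto.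
        - specialize (HN2 i Hi); lia.
        - specialize (HN2 j Hj); lia. }
      destruct Hsign as [Hs|Hs].
      - exists (fun i => f1 (f2 i)). auto.
      (* Reversing the selection turns negative values of [cross] into positive ones. *)
      - exists (fun i => f1 (f2 (N3 - 1 - i)%nat)). split; [|split].
        + intros i Hi'. apply Hb; lia.
        + intros i j Hi' Hj' e. apply Hi in e; lia.
        + intros i j Hij. specialize (Hs (N3 - 1 - j)%nat (N3 - 1 - i)%nat ltac:(lia)).
          assert (Hl : (f2 (N3 - 1 - j) < f2 (N3 - 1 - i))%nat) by (apply Hf2; lia).
          specialize (HN2 (N3 - 1 - i)%nat ltac:(lia)).
          specialize (Hnpar (f2 (N3 - 1 - j)%nat) (f2 (N3 - 1 - i)%nat) ltac:(lia)).
          rewrite cross_antisym. lra. }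
    destruct Hcomp as (h & Hhn & Hhi & Hhc).
    destruct (H3 (fun i j k => 0 <= bend (L (h i)) (L (h j)) (L (h k))))
      as (f3 & Hf3 & HN3 & Hbend).
    assert (Hcross : forall i j, (i < j < K)%nat -> 0 < cross (L (h (f3 i))) (L (h (f3 j)))).
    { intros i j Hij. apply Hhc. split; [apply Hf3|apply HN3]; lia. }
    assert (HW : (forall i, (i < K)%nat -> (h (f3 i) < n)%nat) /\
      (forall i j, (i < K)%nat -> (j < K)%nat -> h (f3 i) = h (f3 j) -> i = j)).
    { split; [auto|]. intros i j Hi Hj e. apply (increasing_inj K f3); auto. }
    destruct HW as [HW1 HW2].
    destruct Hbend as [Hb|Hb].
    + exists (fun i => h (f3 i)), (fun i => L (h (f3 i))).
      split; [|split; [|split]]; auto. left; split; auto.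
    (* Negating all equations keeps [cross], which is of degree two in them, and negates [bend],
       which is of degree three. *)
    + exists (fun i => h (f3 i)), (fun i => opp_line (L (h (f3 i)))).
      split; [|split; [|split]]; auto using on_opp_line.
      left; split.
      * intros i j Hij. rewrite cross_opp. auto.
      * intros i j k Hij Hjk. rewrite bend_opp. specialize (Hb i j k Hij Hjk). lra.
Qed.

(** * The two-sided path and the theorem *)

Lemma bent_or_parallel_shift (K m d : nat) (g : nat -> line) :
  (m + d <= K)%nat -> bent K g \/ parallel K g ->
  bent m (fun i => g (d + i)%nat) \/ parallel m (fun i => g (d + i)%nat).
Proof.
  intros Hm [[H1 H2]|(a & b & q & H1 & H2)].
  - left; split; intros; [apply H1|apply H2]; lia.
  - right. exists a, b, (fun i => q (d + i)%nat). split.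
    + intros i p Hi. apply H1; lia.
    + destruct H2 as [H2|H2]; [left|right]; intros; apply H2; lia.
Qed.

(** Two copies of the pattern, on disjoint blocks of lines, start at the seam between positions 16
    and 17 and run away from it, so that either direction of nesting meets a full copy in its own
    order. *)
Definition two_sided_order : list nat :=
  rev nested_order ++ map (fun i => (17 + i)%nat) nested_order.

Lemma two_sided_order_lt (i : nat) : (i < 34)%nat -> (nth i two_sided_order 0 < 34)%nat.
Proof.
  intros Hi. assert (h : Forall (fun j => (j < 34)%nat) two_sided_order)
    by (simpl; repeat constructor).
  rewrite Forall_forall in h. apply h, nth_In. simpl; lia.
Qed.

Lemma two_sided_order_inj (i j : nat) : (i < 34)%nat -> (j < 34)%nat ->
  nth i two_sided_order 0%nat = nth j two_sided_order 0%nat -> i = j.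
Proof.
  intros Hi Hj. apply NoDup_nth; simpl; try lia.
  repeat (apply NoDup_cons; [simpl; lia|]). apply NoDup_nil.
Qed.

Theorem mainTheorem13 :
  exists c : nat, forall n : nat, (c <= n)%nat ->
    forall L : nat -> line,
      (forall i, (i < n)%nat -> line_ok (L i)) ->
      (forall i j, (i < n)%nat -> (j < n)%nat -> i <> j -> distinct_lines (L i) (L j)) ->
      exists E : nat -> nat -> Prop,
        simple_graph n E /\ planar n E /\ ~ supports n L E.
Proof.
  destruct (homogeneous_lines 34) as [N HN]. exists N. intros n Hn L Hok Hdist.
  destruct (HN n L Hn Hok Hdist) as (w & g & Hw & Hwi & Hg & Hfam).
  set (W := fun i => w (nth i two_sided_order 0%nat)).
  assert (HW : forall i, (i < 34)%nat -> (W i < n)%nat)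
    by (intros; apply Hw, two_sided_order_lt; auto).
  assert (HWi : forall i j, (i < 34)%nat -> (j < 34)%nat -> W i = W j -> i = j)
    by (intros; apply two_sided_order_inj; auto; apply Hwi; auto using two_sided_order_lt).
  assert (HE : forall u v, embedded (path_cube 34) W u v -> (u < n)%nat /\ (v < n)%nat).
  { intros u v (i & j & (Hi & Hj & _) & -> & ->); auto. }
  exists (embedded (path_cube 34) W). split; [|split].
  - split; [|split; [|exact HE]].
    + intros u v (i & j & Hij & -> & ->). exists j, i; auto using path_cube_sym.
    + intros u (i & j & (Hi & Hj & Hne & _) & e1 & e2). subst u.
      apply Hne, HWi; auto.
  - destruct (embedded_straight_drawing n 34 (path_cube 34) W (fun i => spiral (i + 3)))
      as [pos Hpos]; auto.
    + unfold path_cube; lia.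
    + apply nested_straight_drawing; [apply spiral_inside|apply spiral_det].
    + apply (straight_drawing_planar n _ pos); auto.
  (* The identity labelling suffices, since [W] already names path vertices by the indices of their
     lines. *)
  - intros Hsup. destruct (Hsup (fun v => v)) as (pos & HD & Hline).
    { split; [auto|split; [auto|]]. intros i Hi; eauto. }
    assert (HP : straight_drawing 34 (path_cube 34) (fun i => pos (W i))).
    { apply (straight_drawing_restrict n 34 (embedded (path_cube 34) W)); auto.
      intros i j Hij. split; [apply Hij|split; [apply Hij|]]. exists i, j; auto. }
    assert (Hon : forall i, (i < 34)%nat -> on_line (g (nth i two_sided_order 0%nat)) (pos (W i)))
      by (intros; apply Hg; auto using two_sided_order_lt).
    assert (Hsub : forall m f, (forall i, (i < m)%nat -> (f i < 34)%nat) ->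
      (forall i j, (i < m)%nat -> (j < m)%nat -> f i = f j -> i = j) ->
      (forall i j, path_cube m i j -> path_cube 34 (f i) (f j)) ->
      straight_drawing m (path_cube m) (fun i => pos (W (f i)))).
    { intros m f Hf Hi Hc.
      apply (straight_drawing_restrict 34 m (path_cube 34) (path_cube m) (fun i => pos (W i)) f);
        auto.
      intros i j Hij. split; [apply Hij|split; [apply Hij|auto]]. }
    (* With 14 the alternatives start at positions 16 and 17, each one vertex before the copy it
       leads into; one use of [path_cube_next] brings the nesting to the first triangle of that
       copy. *)
    destruct (path_cube_direction 34 _ 14 HP ltac:(lia)) as [h|h]; simpl in h.
    + apply (nested_path_absurd (fun i => g (17 + i)%nat) (fun i => pos (W (17 + i)%nat))).
      * apply (bent_or_parallel_shift 34); auto.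
      * apply Hsub; unfold path_cube; lia.
      * apply (path_cube_next 34 _ 16 HP); [lia|exact h].
      * intros j Hj.
        replace (17 + nth j nested_order 0)%nat with (nth (17 + j) two_sided_order 0%nat);
          [apply Hon; lia|].
        do 17 (destruct j as [|j]; [reflexivity|]). lia.
    + apply (nested_path_absurd (fun i => g (0 + i)%nat) (fun i => pos (W (16 - i)%nat))).
      * apply (bent_or_parallel_shift 34); auto; lia.
      * apply Hsub; unfold path_cube; lia.
      * apply (path_cube_next 18 (fun i => pos (W (17 - i)%nat)) 0); [|lia|exact h].
        apply Hsub; unfold path_cube; lia.
      * intros j Hj.
        replace (0 + nth j nested_order 0)%nat with (nth (16 - j) two_sided_order 0%nat);
          [apply Hon; lia|].
        do 17 (destruct j as [|j]; [reflexivity|]). lia.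
Qed.
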